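(* Let $v\in V$, let $\Gamma$ be any subgroup of $\mathcal{N}_{\langle v\rangle}$ and let $M$ be a finite-dimensional $\langle G,\Gamma\rangle$-module. Then the map $\eta_v\otimes\mathrm{Id}_M:\mathcal{H}\otimes M\to\mathcal{H}_v\otimes M$ induces an isomorphism of $\Gamma$-modules $$(\mathcal{H}\otimes M)^G\otimes_{gr}\theta_v\;\xrightarrow{\ \sim\ }\;(\mathcal{H}_v\otimes M)^{G_v}\otimes_{gr}\theta_v.$$
   Context: Let $K$ be an algebraically closed field of characteristic $0$, $V$ a finite-dimensional $K$-vector space and $G\subset\mathrm{GL}(V)$ a finite group generated by (pseudo)reflections. Let $S$ be the graded algebra of polynomial functions on $V$, with $\mathrm{GL}(V)$ acting by $(gf)(v)=f(g^{-1}v)$, and $\mathcal{N}$ the normaliser of $G$ in $\mathrm{GL}(V)$. For a finite reflection group $W\subset\mathrm{GL}(V)$, the $W$-harmonic polynomials are those annihilated by all $W$-invariant constant-coefficient differential operators without constant term. Let $\mathcal{H}$ be the $G$-harmonic polynomials. For $v\in V$, let $G_v$ be the subgroup of $G$ generated by the reflections fixing $v$, $\mathcal{H}_v$ the $G_v$-harmonic polynomials, $\mathcal{N}_{\langle v\rangle}=\{n\in\mathcal{N}: n(v)\in Kv\}$, and $\theta_v:\mathcal{N}_{\langle v\rangle}\to K^\times$ the character with $n(v)=\theta_v(n)v$. Multiplication gives an isomorphism $S^{G_v}\otimes\mathcal{H}_v\cong S$; let $\eta_v:S\to\mathcal{H}_v$ be the linear map $f\otimes h\mapsto f(v)h$ ($f\in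 S^{G_v}$, $h\in\mathcal{H}_v$), restricted to $\mathcal{H}$. The tensor products $\mathcal{H}\otimes M$, $\mathcal{H}_v\otimes M$ are graded by the degree in $\mathcal{H}$, $\mathcal{H}_v$. For a group $N$, a graded $N$-module $X=\oplus_i X_i$ and a linear character $\theta$, $X\otimes_{gr}\theta=\oplus_i X_i\otimes\theta^i$. *)

(* Defs.v *)
From HB Require Import structures.
From mathcomp Require Import all_boot all_order all_algebra.
From mathcomp Require Import mpoly.
Set Implicit Arguments. Unset Strict Implicit. Unset Printing Implicit Defensive.
Import GRing.Theory.
Local Open Scope ring_scope.

(* V = K^n as column vectors 'cV[K]_n; GL(V) = invertible matrices 'M[K]_n.
   S = {mpoly K[n]} = polynomial functions on V (X_i = i-th coordinate). *)

Section Defs.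
Variables (K : fieldType) (n : nat).
Local Notation mx := 'M[K]_n.
Local Notation S := {mpoly K[n]}.

Definition lin_subst (A : mx) (f : S) : S :=
  comp_mpoly [tuple \sum_(j < n) A i j *: 'X_j | i < n] f.

Definition act (g : mx) (f : S) : S := lin_subst (invmx g) f.

Definition dop (p f : S) : S := \sum_(m <- msupp p) p@_m *: mderivm m f.

Definition evalv (f : S) (v : 'cV[K]_n) : K := f.@[fun i => v i ord0].

Definition twp (c : K) (f : S) : S :=
  \sum_(m <- msupp f) (c ^+ mdeg m * f@_m) *: 'X_[m].

Definition is_group (X : mx -> Prop) : Prop :=
  [/\ X 1%:M,
      (forall x y, X x -> X y -> X (x *m y)) &
      (forall x, X x -> x \in unitmx /\ X (invmx x))].

Definition gen (X : mx -> Prop) (x : mx) : Prop :=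
  exists s : seq mx, (forall y, y \in s -> X y \/ X (invmx y)) /\
    x = foldr (fun a b => a *m b) 1%:M s.

Definition is_finite (X : mx -> Prop) : Prop :=
  exists s : seq mx, forall x, X x <-> x \in s.

(* (pseudo)reflection: non-identity element fixing a hyperplane pointwise *)
Definition reflection (g : mx) : Prop :=
  g \in unitmx /\ \rank (g - 1%:M) = 1%N.

Definition finite_reflection_group (G : mx -> Prop) : Prop :=
  [/\ is_group G, is_finite G &
      forall x, G x <-> gen (fun r => G r /\ reflection r) x].

Definition invariant_dop (W : mx -> Prop) (p : S) : Prop :=
  forall g, W g -> forall f, dop p (act g f) = act g (dop p f).

Definition harmonic (W : mx -> Prop) (f : S) : Prop :=
  forall p : S, p@_0 = 0 -> invariant_dop W p -> dop p f = 0.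

Definition invariant_poly (W : mx -> Prop) (f : S) : Prop :=
  forall g, W g -> act g f = f.

Definition Gv (G : mx -> Prop) (v : 'cV[K]_n) : mx -> Prop :=
  gen (fun r => [/\ G r, reflection r & r *m v = v]).

Definition normaliser (G : mx -> Prop) (x : mx) : Prop :=
  x \in unitmx /\ forall g, G g <-> G (x *m g *m invmx x).

Definition normaliser_line (G : mx -> Prop) (v : 'cV[K]_n) (x : mx) : Prop :=
  normaliser G x /\ exists c : K, x *m v = c *: v.

(* H (x) M with M = K^d: d-tuples of polynomials (coordinates in the
   standard basis of M).  Action of g with rho g acting on M = column vectors *)
Definition tact (d : nat) (rho : mx -> 'M[K]_d) (g : mx) (F : 'I_d -> S)
  : 'I_d -> S :=
  fun i => \sum_(j < d) rho g i j *: act g (F j).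

Definition inv_harm_tensor (d : nat) (rho : mx -> 'M[K]_d)
  (W : mx -> Prop) (F : 'I_d -> S) : Prop :=
  (forall i, harmonic W (F i)) /\ (forall g, W g -> tact rho g F = F).

Definition twact (d : nat) (rho : mx -> 'M[K]_d) (theta : mx -> K)
  (g : mx) (F : 'I_d -> S) : 'I_d -> S :=
  fun i => twp (theta g) (tact rho g F i).

End Defs.

(* Main.v *)
(** For a group [W], write [S^W_+] for the invariants without constant term, [I_W = S . S^W_+],
    and [H_W] for the harmonics.

    Any finite group: [S = H_W + I_W].  Embed [V] in [U = V^|W|] by [x |-> (g x)_g], so that [W]
    acts on [U] by 0/1 matrices; the pairing [<p, f> = (p(d) f)(0)] is positive definite on
    integral polynomials, so Gram-Schmidt over [int] (up to nonzero scalars) splits every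
    monomial of [U], and base change to [K] followed by restriction to [V] gives the claim.  The
    same statement for the contragredient group shows that the top-degree part of a nonzero
    harmonic polynomial is not in [I_W].  Hence [S = S^W H_W], which determines [eta].

    Injectivity: let [Q_v] be the ideal generated by the [G_v]-invariants vanishing at [v], so
    that [f - eta f] lies in [Q_v].  The ideal [Q] of all [f] with [g f] in [Q_v] for every [g] in
    [G] is stable under the divided differences [(r f - f) / L_r].  By Chevalley's averaging
    argument, some chain of divided differences maps a nonzero harmonic [f] to a nonzero
    constant; so [f] in [H] and in [Q] forces [f = 0].  If [F] in [(H (x) M)^G] has [eta F = 0], its
    components are in [Q] by invariance.

    Surjectivity: let [u] have trivial stabiliser in [G].  Evaluation at [u] maps
    [(H (x) M)^G] onto [M] (interpolate by harmonics on the orbit of [u]), and it is injective on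
    [(H_v (x) M)^(G_v)] by the previous paragraph applied to [G_v] and [u].  The injective map
    [eta (x) Id] is therefore bijective.  Steinberg's fixed point theorem is not needed. *)
Require Import Defs.
From HB Require Import structures.
From mathcomp Require Import all_boot all_order all_algebra.
From mathcomp Require Import mpoly.
From mathcomp Require Import ssrcomplements.
From Stdlib Require Import Classical FunctionalExtensionality.
Set Implicit Arguments. Unset Strict Implicit. Unset Printing Implicit Defensive.
Import Order.TTheory GRing.Theory Num.Theory.
Local Open Scope ring_scope.

(** * Constant-coefficient operators and linear substitutions *)

Lemma mpoly_alg_ind (R : comNzRingType) n (P : {mpoly R[n]} -> Prop) :
  (forall c, P c%:MP) -> (forall i, P 'X_i) ->
  (forall f g, P f -> P g -> P (f + g)) ->
  (forall f g, P f -> P g -> P (f * g)) -> forall f, P f.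
Proof.
move=> PC PX PD PM f.
rewrite [f]mpolyE; elim/big_ind: _ => // [|m _]; first by rewrite -mpolyC0.
rewrite -mul_mpolyC; apply: (PM) => //; rewrite mpolyXE_id.
elim/big_ind: _ => [|x y|i _]; [by rewrite -mpolyC1 | exact: PM |].
by elim: (m i) => [|k ih]; rewrite ?expr0 -?mpolyC1 // exprS; apply: PM.
Qed.

Lemma mpoly_lin_ind (R : comNzRingType) n (P : {mpoly R[n]} -> Prop) :
  P 0 -> (forall f g, P f -> P g -> P (f + g)) ->
  (forall c f, P f -> P (c *: f)) ->
  forall f, (forall m, m \in msupp f -> P 'X_[m]) -> P f.
Proof.
move=> P0 PD PZ f Pm; rewrite [f]mpolyE big_seq_cond.
by apply: big_ind => // m /andP[fm _]; apply/PZ/Pm.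
Qed.

Lemma msize_leP (R : nzRingType) n (f : {mpoly R[n]}) k :
  reflect (forall m, m \in msupp f -> (mdeg m < k)%N) (msize f <= k)%N.
Proof.
apply: (iffP idP) => [le_fk m /msize_mdeg_lt lt_mf|h]; first exact: leq_trans le_fk.
rewrite mmeasureE big_seq; elim/big_ind: _ => // x y hx hy.
by rewrite geq_max hx.
Qed.

Section PDiff.
Variables (R : comNzRingType) (n : nat).
Implicit Types p q f g : {mpoly R[n]}.

(** The formula of [dop], over any commutative ring, because the orthogonalisation takes place over
    [int] before base change to [K]. *)
Definition pdiff p f : {mpoly R[n]} := \sum_(m <- msupp p) p@_m *: f^`M[m].

Lemma pdiffwE k p f : (msize p <= k)%N ->
  pdiff p f = \sum_(m : 'X_{1..n < k}) p@_m *: f^`M[m].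
Proof.
move=> le_pk; set I : subFinType _ := 'X_{1..n < k}.
rewrite /pdiff (big_mksub I) ?msupp_uniq //=; last first.
  by move=> x /msize_mdeg_lt /leq_trans; apply.
rewrite big_rmcond //= => j /memN_msupp_eq0 ->.
by rewrite scale0r.
Qed.

Lemma pdiff_is_linear p : linear (pdiff p).
Proof.
move=> c f g; rewrite /pdiff scaler_sumr -big_split; apply: eq_bigr => m _.
by rewrite /= linearP scalerDr !scalerA mulrC.
Qed.

HB.instance Definition _ p :=
  GRing.isLinear.Build R {mpoly R[n]} {mpoly R[n]} _ (pdiff p) (pdiff_is_linear p).

Lemma pdiffZr p c f : pdiff p (c *: f) = c *: pdiff p f.
Proof. exact: linearZ. Qed.

Lemma pdiffBr p f g : pdiff p (f - g) = pdiff p f - pdiff p g.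
Proof. exact: linearB. Qed.

Lemma pdiffDl p q f : pdiff (p + q) f = pdiff p f + pdiff q f.
Proof.
set k := maxn (msize p) (msize q).
rewrite (@pdiffwE k (p + q)) ?msizeD_le // (@pdiffwE k p) ?leq_maxl //.
rewrite (@pdiffwE k q) ?leq_maxr // -big_split; apply: eq_bigr => m _.
by rewrite mcoeffD scalerDl.
Qed.

Lemma pdiffZl c p f : pdiff (c *: p) f = c *: pdiff p f.
Proof.
rewrite (@pdiffwE (msize p) (c *: p)) ?msizeZ_le // (@pdiffwE (msize p) p) //.
by rewrite scaler_sumr; apply: eq_bigr => m _; rewrite mcoeffZ scalerA.
Qed.

Lemma pdiff0l f : pdiff 0 f = 0.
Proof. by rewrite /pdiff msupp0 big_nil. Qed.

Lemma pdiff_suml (I : Type) (r : seq I) (P : pred I) (F : I -> {mpoly R[n]}) f :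
  pdiff (\sum_(i <- r | P i) F i) f = \sum_(i <- r | P i) pdiff (F i) f.
Proof.
by apply: (big_morph (pdiff^~ f)); [move=> p q; apply: pdiffDl | apply: pdiff0l].
Qed.

Lemma pdiffXm m f : pdiff 'X_[m] f = f^`M[m].
Proof. by rewrite /pdiff msuppX big_seq1 mcoeffX eqxx scale1r. Qed.

Lemma pdiffX i f : pdiff 'X_i f = f^`M(i).
Proof. by rewrite pdiffXm mderivmU1m. Qed.

Lemma pdiffC c f : pdiff c%:MP f = c *: f.
Proof.
by rewrite -[c%:MP]mulr1 mul_mpolyC pdiffZl -mpolyX0 pdiffXm mderivm0m.
Qed.

Lemma pdiff_mul p q f : pdiff (p * q) f = pdiff p (pdiff q f).
Proof.
have XX a b : pdiff ('X_[a] * 'X_[b]) f = pdiff 'X_[a] (pdiff 'X_[b] f).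
  by rewrite -mpolyXD addmC !pdiffXm mderivmDm.
rewrite [p]mpolyE mulr_suml !pdiff_suml; apply: eq_bigr => a _.
rewrite [q]mpolyE mulr_sumr !pdiff_suml linear_sum; apply: eq_bigr => b _.
rewrite -scalerAl -scalerAr /= !pdiffZl [in RHS]linearZ /= XX.
by [].
Qed.

(** The apolar pairing: monomials are orthogonal with products of factorials as norms, and
    multiplication by [q] is adjoint to [pdiff q]. *)
Definition pairing p f : R := (pdiff p f)@_0.

Lemma pairingE p f :
  pairing p f = \sum_(m <- msupp p) p@_m * f@_m * (\prod_(i < n) (m i)`!)%:R.
Proof.
rewrite /pairing /pdiff raddf_sum /=; apply: eq_bigr => m _.
rewrite mcoeffZ mcoeff_mderivm addm0 -mulrA mulr_natr; congr (_ * (_ *+ _)).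
by apply: eq_bigr => i _; rewrite ffactnn.
Qed.

Lemma pairingwE k p f : (msize p <= k)%N ->
  pairing p f = \sum_(m : 'X_{1..n < k}) p@_m * f@_m * (\prod_(i < n) (m i)`!)%:R.
Proof.
move=> le_pk; rewrite pairingE; set I : subFinType _ := 'X_{1..n < k}.
rewrite (big_mksub I) ?msupp_uniq //=; last first.
  by move=> x /msize_mdeg_lt /leq_trans; apply.
by rewrite big_rmcond //= => j /memN_msupp_eq0 ->; rewrite !mul0r.
Qed.

Lemma pairingC p f : pairing p f = pairing f p.
Proof.
set k := maxn (msize p) (msize f).
rewrite (@pairingwE k p) ?leq_maxl // (@pairingwE k f) ?leq_maxr //.
by apply: eq_bigr => m _; rewrite [p@_m * _]mulrC.
Qed.

Lemma pairingMl p q f : pairing (p * q) f = pairing p (pdiff q f).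
Proof. by rewrite /pairing pdiff_mul. Qed.

Lemma pairingXl m f : pairing 'X_[m] f = f@_m * (\prod_(i < n) (m i)`!)%:R.
Proof. by rewrite pairingE msuppX big_seq1 mcoeffX eqxx mul1r. Qed.

Lemma pdiff_homog p f d e : p \is e.-homog -> f \is (e + d).-homog ->
  pdiff p f \is d.-homog.
Proof.
move=> hp hf; rewrite /pdiff big_seq; apply: rpred_sum => m pm.
apply: rpredZ; apply/dhomogP => k; rewrite mcoeff_msupp mcoeff_mderivm => h.
have : (m + k)%MM \in msupp f.
  by rewrite mcoeff_msupp; apply: contraNneq h => ->; rewrite mul0rn.
move/(dhomogP _ _ _ hf); rewrite /= mdegD (dhomogP _ _ _ hp m pm).
by move/addnI.
Qed.

Lemma pdiff_homog_lt p f d e : p \is e.-homog -> f \is d.-homog -> (d < e)%N ->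
  pdiff p f = 0.
Proof.
move=> hp hf lt_de; rewrite /pdiff big_seq big1 // => m pm.
suff -> : f^`M[m] = 0 by rewrite scaler0.
apply/mpolyP => k; rewrite mcoeff_mderivm mcoeff0.
rewrite (dhomog_nemf_coeff hf) ?mul0rn //= mdegD (dhomogP _ _ _ hp m pm) /=.
by rewrite neq_ltn orbC (leq_trans lt_de) ?leq_addr.
Qed.

End PDiff.

(** Composition with the linear map of [A], rectangular so as to cover embeddings and retractions;
    it is contravariant in [A], so groups act on the right. *)
HB.lock Definition lsub (R : comNzRingType) k n (A : 'M[R]_(k, n))
    (f : {mpoly R[k]}) : {mpoly R[n]} :=
  comp_mpoly [tuple \sum_(j < n) A i j *: 'X_j | i < k] f.

Section LSub.
Variable R : comNzRingType.

Lemma lsubE k n (A : 'M[R]_(k, n)) f :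
  lsub A f = comp_mpoly [tuple \sum_(j < n) A i j *: 'X_j | i < k] f.
Proof. by rewrite lsub.unlock. Qed.

Fact lsub_is_linear k n (A : 'M[R]_(k, n)) : linear (lsub A).
Proof. by move=> c f g; rewrite !lsubE linearP. Qed.

Fact lsub_is_monoid_morphism k n (A : 'M[R]_(k, n)) : monoid_morphism (lsub A).
Proof. by split=> [|f g]; rewrite !lsubE ?rmorph1 ?rmorphM. Qed.

HB.instance Definition _ k n A :=
  GRing.isLinear.Build R {mpoly R[k]} {mpoly R[n]} _ (@lsub R k n A) (lsub_is_linear A).
HB.instance Definition _ k n A :=
  GRing.isMonoidMorphism.Build {mpoly R[k]} {mpoly R[n]} (@lsub R k n A)
    (lsub_is_monoid_morphism A).

Lemma lsubC k n (A : 'M[R]_(k, n)) c : lsub A c%:MP = c%:MP.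
Proof. by rewrite lsubE comp_mpolyC. Qed.

Lemma lsubX k n (A : 'M[R]_(k, n)) i : lsub A 'X_i = \sum_(j < n) A i j *: 'X_j.
Proof. by rewrite lsubE comp_mpolyXU -tnth_nth tnth_mktuple. Qed.

Lemma lsub_lsub k n p (A : 'M[R]_(k, n)) (B : 'M[R]_(n, p)) f :
  lsub B (lsub A f) = lsub (A *m B) f.
Proof.
elim/mpoly_alg_ind: f => [c|i|f g hf hg|f g hf hg]; rewrite ?lsubC //.
- rewrite !lsubX linear_sum /=.
  transitivity (\sum_(j < n) \sum_(l < p) (A i j * B j l) *: ('X_l : {mpoly R[p]})).
    apply: eq_bigr => j _; rewrite linearZ /= lsubX scaler_sumr.
    by apply: eq_bigr => l _; rewrite scalerA.
  rewrite exchange_big; apply: eq_bigr => l _.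
  by rewrite mxE scaler_suml.
- by rewrite !raddfD /= hf hg.
- by rewrite !rmorphM /= hf hg.
Qed.

Lemma lsub1 n (f : {mpoly R[n]}) : lsub 1%:M f = f.
Proof.
elim/mpoly_alg_ind: f => [c|i|f g hf hg|f g hf hg]; rewrite ?lsubC //.
- rewrite lsubX (bigD1 i) //= big1 => [|j ne]; rewrite mxE ?eqxx ?scale1r ?addr0 //.
  by rewrite eq_sym (negbTE ne) scale0r.
- by rewrite raddfD /= hf hg.
- by rewrite rmorphM /= hf hg.
Qed.

Lemma lsub_homog k n (A : 'M[R]_(k, n)) d f :
  f \is d.-homog -> lsub A f \is d.-homog.
Proof.
move=> hf; apply: (@mpoly_lin_ind _ _ (fun f => lsub A f \is d.-homog)).
- by rewrite raddf0 dhomog0.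
- by move=> g h hg hh; rewrite raddfD /= rpredD.
- by move=> c g hg; rewrite linearZ /= rpredZ.
move=> m /(dhomogP _ _ _ hf) /= <-.
have hX i : lsub A 'X_i \is 1.-homog.
  by rewrite lsubX; apply: rpred_sum => j _; rewrite rpredZ // dhomogX /= mdeg1.
rewrite mpolyXE_id rmorph_prod mdegE.
elim/big_ind2: _ => [|f1 x1 f2 x2 h1 h2|i _]; first exact: dhomog1.
  exact: dhomogM.
by rewrite rmorphXn /= -[X in X.-homog]mul1n; apply: dhomogMn.
Qed.

Lemma msize_homog n (f : {mpoly R[n]}) d : f \is d.-homog -> (msize f <= d.+1)%N.
Proof.
move=> hf; apply/msize_leP => m fm.
by rewrite ltnS (dhomogP _ _ _ hf m fm).
Qed.

Lemma lsub_msize k n (A : 'M[R]_(k, n)) f d :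
  (msize f <= d)%N -> (msize (lsub A f) <= d)%N.
Proof.
move=> hf; apply: (@mpoly_lin_ind _ _ (fun f => msize (lsub A f) <= d)%N).
- by rewrite raddf0 mmeasure0.
- by move=> g h hg hh; rewrite raddfD /= (leq_trans (msizeD_le _ _)) // geq_max hg.
- by move=> c g hg; rewrite linearZ /= (leq_trans (msizeZ_le _ _)).
move=> m /msize_mdeg_lt fm.
apply: leq_trans (leq_trans fm hf).
by apply: msize_homog; apply: lsub_homog; rewrite dhomogX.
Qed.

Lemma lsub_coeff0 k n (A : 'M[R]_(k, n)) f : (lsub A f)@_0 = f@_0.
Proof.
elim/mpoly_alg_ind: f => [c|i|f g hf hg|f g hf hg].
- by rewrite lsubC !mcoeffC !eqxx.
- rewrite lsubX raddf_sum mcoeffX mnm1_eq0 big1 // => j _ /=.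
  by rewrite mcoeffZ mcoeffX mnm1_eq0 mulr0.
- by rewrite raddfD /= !mcoeffD hf hg.
- by rewrite !rmorphM /= hf hg.
Qed.

Lemma mderiv_lsub k n (A : 'M[R]_(k, n)) (i : 'I_n) f :
  (lsub A f)^`M(i) = \sum_(l < k) A l i *: lsub A (f^`M(l)).
Proof.
elim/mpoly_alg_ind: f => [c|j|f g hf hg|f g hf hg].
- rewrite lsubC mderivC big1 // => l _.
  by rewrite mderivC raddf0 scaler0.
- have X1 (p : nat) (a b : 'I_p) : ('X_a)^`M(b) = (a == b)%:R :> {mpoly R[p]}.
    rewrite mderivX mnm1E; have [->|_] := eqVneq a b; last by rewrite scale0r.
    by rewrite scale1r -mpolyX0; congr 'X_[_]; apply/mnmP=> c; rewrite mnmBE subnn mnm0E.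
  rewrite lsubX linear_sum (bigD1 i) //= [X in _ + X]big1 ?addr0 => [|l ne].
    rewrite (bigD1 j) //= [X in _ + X]big1 ?addr0 => [|l ne].
      by rewrite linearZ /= !X1 !eqxx rmorph_nat.
    by rewrite X1 eq_sym (negbTE ne) raddf0 scaler0.
  by rewrite linearZ /= X1 (negbTE ne) scaler0.
- rewrite raddfD mderivD /= hf hg -big_split; apply: eq_bigr => l _.
  by rewrite mderivD raddfD scalerDr.
- rewrite rmorphM /= mderivM hf hg mulr_suml mulr_sumr -big_split.
  apply: eq_bigr => l _.
  by rewrite mderivM raddfD /= !rmorphM scalerDr /= scalerAl scalerAr.
Qed.

(** By the chain rule, symbols of operators transform under the transpose; hence the [g^T] in every
    invariance condition on operators. *)
Lemma pdiff_lsub k n (A : 'M[R]_(k, n)) p f :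
  pdiff p (lsub A f) = lsub A (pdiff (lsub A^T p) f).
Proof.
elim/mpoly_alg_ind: p f => [c|i|p q hp hq|p q hp hq] f.
- by rewrite lsubC !pdiffC linearZ.
- rewrite pdiffX mderiv_lsub lsubX pdiff_suml linear_sum.
  by apply: eq_bigr => l _; rewrite pdiffZl pdiffX linearZ mxE.
- by rewrite raddfD !pdiffDl raddfD /= hp hq.
- by rewrite rmorphM !pdiff_mul /= hq hp.
Qed.

Lemma lsub_eval k n (A : 'M[R]_(k, n)) f (v : 'cV[R]_n) :
  (lsub A f).@[fun i => v i ord0] = f.@[fun i => (A *m v) i ord0].
Proof.
rewrite lsubE comp_mpoly_meval; apply: meval_eq => i.
rewrite tnth_mktuple raddf_sum mxE; apply: eq_bigr => j _.
by rewrite /= mevalZ mevalXU.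
Qed.

End LSub.

(** * Denominator-free orthogonal projection *)

(** [pairing f f] is a sum of squares with positive weights, so each coefficient vanishes. *)
Lemma pairing_def (R : realDomainType) n (f : {mpoly R[n]}) :
  pairing f f = 0 -> f = 0.
Proof.
have fact_gt0 (m : 'X_{1..n}) : 0 < (\prod_(i < n) (m i)`!)%:R :> R.
  by rewrite ltr0n; apply: prodn_gt0 => i; apply: fact_gt0.
rewrite pairingE => /eqP.
rewrite psumr_eq0 => [/allP z|m _]; last first.
  by apply: mulr_ge0; [rewrite -expr2 sqr_ge0 | exact: ltW].
apply/eqP; rewrite -msize_poly_eq0 -leqn0; apply/msize_leP => m fm.
have := z m fm; rewrite /= !mulf_eq0 orbb mcoeff_eq0 fm /=.
by rewrite gt_eqF.
Qed.

(** * Linear closure, spans and spans of products *)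

Section Span.
Variables (R : comNzRingType) (n : nat).
Local Notation S := {mpoly R[n]}.

Definition lin_closed (P : S -> Prop) : Prop :=
  [/\ P 0, forall x y, P x -> P y -> P (x + y) & forall c x, P x -> P (c *: x)].

Definition lspan (B : seq S) (f : S) : Prop :=
  forall P, lin_closed P -> (forall b, b \in B -> P b) -> P f.

Lemma lin_closed_lspan B : lin_closed (lspan B).
Proof.
split=> [P [] //|x y hx hy P hP hB|c x hx P hP hB]; have [_ PD PZ] := hP.
  by apply: PD; [apply: hx | apply: hy].
by apply: PZ; apply: hx.
Qed.

Lemma lin_closedB P x y : lin_closed P -> P x -> P y -> P (x - y).
Proof. by move=> [_ PD PZ] hx hy; rewrite -scaleN1r; apply/PD/PZ. Qed.

Lemma lin_closed_sum P I (r : seq I) (Q : pred I) (F : I -> S) : lin_closed P ->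
  (forall i, Q i -> P (F i)) -> P (\sum_(i <- r | Q i) F i).
Proof. by move=> [P0 PD _] h; elim/big_ind: _. Qed.

(* Sums of products [a * b] with [A a] and [B b]: both an ideal generated by
   [B] and a span [S^W . H] are of this form. *)
Inductive prodspan (A B : S -> Prop) : S -> Prop :=
| Prodspan0 : prodspan A B 0
| ProdspanD a b f : A a -> B b -> prodspan A B f -> prodspan A B (a * b + f).

Lemma prodspanM A B a b : A a -> B b -> prodspan A B (a * b).
Proof. by move=> ha hb; rewrite -[_ * _]addr0; apply: ProdspanD => //; apply: Prodspan0. Qed.

Lemma prodspan_add A B f g : prodspan A B f -> prodspan A B g -> prodspan A B (f + g).
Proof.
by elim=> [|a b h ha hb _ ih] hg; rewrite ?add0r // -addrA; apply: ProdspanD => //; apply: ih.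
Qed.

Lemma prodspan_lin A B : (forall c a, A a -> A (c *: a)) -> lin_closed (prodspan A B).
Proof.
move=> AZ; split=> [|x y|c x]; [exact: Prodspan0 | exact: prodspan_add |].
elim=> [|a b h ha hb _ ih]; first by rewrite scaler0; apply: Prodspan0.
by rewrite scalerDr scalerAl; apply: ProdspanD => //; apply: AZ.
Qed.

Lemma prodspan_mul A B x f : (forall a, A a -> A (x * a)) ->
  prodspan A B f -> prodspan A B (x * f).
Proof.
move=> Ax; elim=> [|a b h ha hb _ ih]; first by rewrite mulr0; apply: Prodspan0.
by rewrite mulrDr mulrA; apply: ProdspanD => //; apply: Ax.
Qed.

End Span.

Lemma prodspan_map (R R' : comNzRingType) n n' (phi : {rmorphism {mpoly R[n]} -> {mpoly R'[n']}})
    (A B : {mpoly R[n]} -> Prop) (A' B' : {mpoly R'[n']} -> Prop) f :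
  (forall a, A a -> A' (phi a)) -> (forall b, B b -> B' (phi b)) ->
  prodspan A B f -> prodspan A' B' (phi f).
Proof.
move=> hA hB; elim=> [|a b h ha hb _ ih]; first by rewrite rmorph0; apply: Prodspan0.
by rewrite rmorphD rmorphM; apply: ProdspanD; auto.
Qed.

Section GramSchmidt.
Variables (R : realDomainType) (n : nat).
Local Notation S := {mpoly R[n]}.

Lemma pairing_linl (h : S) : lin_closed (fun l => pairing l h = 0).
Proof.
split=> [|x y hx hy|c x hx]; rewrite /pairing.
- by rewrite pdiff0l mcoeff0.
- by rewrite pdiffDl mcoeffD [X in X + _]hx [X in _ + X]hy addr0.
- by rewrite pdiffZl mcoeffZ [X in _ * X]hx mulr0.
Qed.

Lemma pairing_linr (b : S) : lin_closed (fun l => pairing b l = 0).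
Proof.
have [h0 hD hZ] := pairing_linl b.
by split=> [|x y|c x]; rewrite !(pairingC b); [| apply: hD | apply: hZ].
Qed.

(* Denominator-free: the conclusion survives base change along [int -> K]. *)
Lemma gram_schmidt (B : seq S) (f : S) : exists (c : R) (h : S),
  [/\ c != 0, lspan B (c *: f - h) & forall b : S, b \in B -> pairing b h = 0].
Proof.
have spanW (b : S) B' x : lspan B' x -> lspan (b :: B') x.
  by move=> hx P hP hB; apply: hx => // y yB; apply: hB; rewrite inE yB orbT.
elim: B f => [|b B ih] f.
  exists 1, f; split; rewrite ?oner_neq0 // scale1r subrr.
  by case: (lin_closed_lspan (Nil S)).
have [cb [b' [cb0 hb' ob']]] := ih b.
have [c [f' [c0 hf' of']]] := ih f.
(* [cb *: b - b'] lies in the span of [B] and [cb] is nonzero, so [b'] may stand in for [b]. *)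
have key h : (forall y, y \in B -> pairing y h = 0) -> pairing b' h = 0 -> pairing b h = 0.
  move=> hB hb.
  have : pairing (cb *: b - b') h = 0.
    by apply: (hb' (fun l => pairing l h = 0)) => //; apply: pairing_linl.
  rewrite /pairing -scaleN1r pdiffDl !pdiffZl mcoeffD !mcoeffZ.
  rewrite [X in -1 * X]hb mulr0 addr0 => /eqP.
  by rewrite mulf_eq0 (negbTE cb0) => /eqP.
have [b'0|b'n0] := eqVneq b' 0.
  exists c, f'; split=> //; first exact: spanW.
  move=> y; rewrite inE => /orP[/eqP ->|]; last exact: of'.
  by apply: key => //; rewrite b'0 /pairing pdiff0l mcoeff0.
(* Scaling by the norm [N] replaces the division in the usual projection of [f'] along [b']. *)
pose N := pairing b' b'.
have N0 : N != 0 by apply: contraNneq b'n0 => /pairing_def ->.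
have oh y : y \in B -> pairing y (N *: f' - pairing b' f' *: b') = 0.
  have [_ _ hZ] := pairing_linr y.
  by move=> yB; apply: (lin_closedB (pairing_linr y)); apply: hZ; [apply: of' | apply: ob'].
have [_ LD LZ] := lin_closed_lspan (b :: B).
exists (N * c), (N *: f' - pairing b' f' *: b'); split; first by rewrite mulf_neq0.
  rewrite -scalerA opprB addrCA addrC -scalerBr; apply: LD; apply: (LZ).
    exact: spanW.
  rewrite -[b'](subKr (cb *: b)); apply: (lin_closedB (lin_closed_lspan _)).
    by apply: LZ => P _; apply; rewrite inE eqxx.
  exact: spanW.
move=> y; rewrite inE => /orP[/eqP ->|]; last exact: oh.
apply: key => //.
rewrite /pairing pdiffBr !pdiffZr mcoeffB !mcoeffZ [X in X - _]mulrC.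
exact: subrr.
Qed.

End GramSchmidt.

(** For nonzero polynomials [msize] is the degree plus one, so the bound means degree below [d]; it
    keeps cofactors small enough for an induction on degree. *)
Definition msize_below (R : comNzRingType) n d (a : {mpoly R[n]}) : Prop := (msize a <= d)%N.

Lemma msize_belowZ (R : comNzRingType) n d c (a : {mpoly R[n]}) :
  msize_below d a -> msize_below d (c *: a).
Proof. exact/leq_trans/msizeZ_le. Qed.

(** [h] is the component of a multiple of [f] orthogonal to the degree-[d] part of the ideal
    generated by the [o m]. Adjointness turns orthogonality to all multiples of [o m] into
    annihilation by its operator. *)
Lemma homog_decomposition (R : realDomainType) n (o : 'X_{1..n} -> {mpoly R[n]})
    (ho : forall m, o m \is (mdeg m).-homog) d (f : {mpoly R[n]}) :
  f \is d.-homog -> exists (c : R) (h : {mpoly R[n]}),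
  [/\ c != 0, h \is d.-homog,
      prodspan (msize_below d) (fun b => exists2 m, m != 0%MM & b = o m) (c *: f - h)
    & forall m, m != 0%MM -> pdiff (o m) h = 0].
Proof.
move=> hf.
pose ok (km : 'X_{1..n < d.+1} * 'X_{1..n < d.+1}) :=
  (mdeg km.1 + mdeg km.2 == d)%N && (km.2 != 0%MM :> 'X_{1..n}).
pose F (km : 'X_{1..n < d.+1} * 'X_{1..n < d.+1}) := 'X_[km.1] * o km.2.
pose B : seq {mpoly R[n]} := [seq F km | km <- enum ok].
have [c [h [c0 hh oh]]] := gram_schmidt B f.
have homogB (b : {mpoly R[n]}) : b \in B -> b \is d.-homog.
  case/mapP=> km; rewrite mem_enum => /andP[/eqP e _] ->.
  by rewrite -[X in X.-homog]e; apply: dhomogM; rewrite ?dhomogX.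
have h_homog : h \is d.-homog.
  rewrite -[h](subKr (c *: f)) rpredB ?rpredZ //.
  apply: (hh (fun x => x \is d.-homog)) => //.
  by split=> [|x y|a x]; [apply: rpred0 | apply: rpredD | apply: rpredZ].
exists c, h; split=> //.
  apply: hh; first by apply: prodspan_lin => a x; apply: msize_belowZ.
  move=> b /mapP[km]; rewrite mem_enum => /andP[/eqP e km0] ->.
  apply: prodspanM; last by exists (bmnm km.2).
  have : (0 < mdeg km.2)%N by rewrite lt0n mdeg_eq0.
  move=> km2; rewrite /msize_below msizeX.
  apply: (@leq_trans (mdeg km.1 + mdeg km.2)); last by rewrite e.
  by rewrite -addn1 leq_add2l.
move=> m m0; have [le_md|lt_dm] := leqP (mdeg m) d; last first.
  exact: pdiff_homog_lt (ho m) h_homog lt_dm.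
have hd : pdiff (o m) h \is (d - mdeg m).-homog.
  by apply: pdiff_homog (ho m) _; rewrite subnKC.
apply/mpolyP => k; rewrite mcoeff0.
have [ek|nk] := eqVneq (mdeg k) (d - mdeg m)%N; last exact: dhomog_nemf_coeff hd nk.
have ltk : (mdeg k < d.+1)%N by rewrite ek ltnS leq_subr.
have ltm : (mdeg m < d.+1)%N by [].
(* Up to a nonzero factor, this pairing is the coefficient of [k] in [pdiff (o m) h]. *)
have : pairing ('X_[k] * o m) h = 0.
  apply: oh; apply/mapP; exists (BMultinom ltk, BMultinom ltm) => //.
  by rewrite mem_enum; apply/andP; rewrite /= ek subnK.
rewrite pairingMl pairingXl => /eqP; rewrite mulf_eq0 => /orP[/eqP //|].
by rewrite pnatr_eq0 -leqn0 leqNgt prodn_gt0 // => i; apply: fact_gt0.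
Qed.

(** * Base change of coefficients *)

Section BaseChange.
Variables (R R' : comNzRingType) (phi : {rmorphism R -> R'}).

Lemma map_mpoly_lsub k n (A : 'M[R]_(k, n)) f :
  map_mpoly phi (lsub A f) = lsub (map_mx phi A) (map_mpoly phi f).
Proof.
elim/mpoly_alg_ind: f => [c|i|f g hf hg|f g hf hg].
- by rewrite lsubC !map_mpolyC lsubC.
- rewrite map_mpolyX !lsubX raddf_sum; apply: eq_bigr => j _.
  by rewrite /= map_mpolyZ map_mpolyX mxE.
- by rewrite !raddfD /= hf hg.
- by rewrite !rmorphM /= hf hg.
Qed.

Lemma map_mpoly_pdiff n (p f : {mpoly R[n]}) :
  map_mpoly phi (pdiff p f) = pdiff (map_mpoly phi p) (map_mpoly phi f).
Proof.
elim/mpoly_alg_ind: p f => [c|i|p q hp hq|p q hp hq] f.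
- by rewrite map_mpolyC !pdiffC map_mpolyZ.
- rewrite map_mpolyX !pdiffX; apply/mpolyP => m.
  by rewrite mcoeff_map_mpoly !mcoeff_mderiv mcoeff_map_mpoly raddfMn.
- by rewrite raddfD !pdiffDl raddfD /= hp hq.
- by rewrite rmorphM !pdiff_mul /= hp hq.
Qed.

Lemma map_mpoly_homog n d (f : {mpoly R[n]}) :
  f \is d.-homog -> map_mpoly phi f \is d.-homog.
Proof.
move=> hf; apply/dhomogP => m; rewrite mcoeff_msupp mcoeff_map_mpoly => fm.
apply: (dhomogP _ _ _ hf); rewrite mcoeff_msupp.
by apply: contraNneq fm => ->; rewrite raddf0.
Qed.

Lemma map_mpoly_msize n d (f : {mpoly R[n]}) :
  (msize f <= d)%N -> (msize (map_mpoly phi f) <= d)%N.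
Proof.
move=> hf; apply/msize_leP => m; rewrite mcoeff_msupp mcoeff_map_mpoly => fm.
apply: leq_trans hf; apply: msize_mdeg_lt; rewrite mcoeff_msupp.
by apply: contraNneq fm => ->; rewrite raddf0.
Qed.

End BaseChange.

(** * Invariants and harmonics of a finite group given as a list *)

Section Invariants.
Variables (K : fieldType) (n : nat).
Local Notation mx := 'M[K]_n.
Local Notation S := {mpoly K[n]}.
Implicit Types (s : seq mx) (g h : mx) (f p : S).

Definition group_seq s : Prop := uniq s /\ is_group (fun x => x \in s).

Definition group_invariant s f : Prop := forall g, g \in s -> lsub g f = f.

Definition group_invariant0 s f : Prop := group_invariant s f /\ f@_0 = 0.

(** In characteristic 0 an operator commutes with the substitution by [g] exactly when its symbol is
    fixed by that of [g^T]; harmonicity is therefore phrased through symbols. *)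
Definition dual_harmonic s f : Prop :=
  forall p, p@_0 = 0 -> (forall g, g \in s -> lsub g^T p = p) -> pdiff p f = 0.

Lemma group_seq_perml s h : group_seq s -> h \in s ->
  perm_eq [seq h *m g | g <- s] s.
Proof.
move=> [us [_ hM hV]] hs; have [hu hVs] := hV _ hs.
have inj : injective (mulmx h : mx -> mx) by move=> x y e; rewrite -(mulKmx hu x) e mulKmx.
apply: uniq_perm; rewrite ?map_inj_uniq // => x; apply/mapP/idP => [[g gs ->]|xs].
  exact: hM.
by exists (invmx h *m x); rewrite ?mulKVmx //; apply: hM.
Qed.

Lemma group_seq_permr s h : group_seq s -> h \in s ->
  perm_eq [seq g *m h | g <- s] s.
Proof.
move=> [us [_ hM hV]] hs; have [hu hVs] := hV _ hs.
have inj : injective (mulmx^~ h : mx -> mx) by move=> x y /= e; rewrite -(mulmxK hu x) e mulmxK.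
apply: uniq_perm; rewrite ?map_inj_uniq // => x; apply/mapP/idP => [[g gs ->]|xs].
  exact: hM.
by exists (x *m invmx h); rewrite ?mulmxKV //; apply: hM.
Qed.

Lemma sum_orbit_invariant s f : group_seq s -> group_invariant s (\sum_(g <- s) lsub g f).
Proof.
move=> gs h hs; rewrite raddf_sum /=.
rewrite -[in RHS](perm_big _ (group_seq_permr gs hs)) big_map.
by apply: eq_bigr => g _; rewrite lsub_lsub.
Qed.

End Invariants.

(** * Decomposition into harmonics and the invariant ideal *)

Section Decomposition.
Variables (K : fieldType) (charK0 : [pchar K] =i pred0) (n : nat).
Local Notation mx := 'M[K]_n.
Local Notation S := {mpoly K[n]}.
Variables (s : seq mx) (gs : group_seq s).

Let U : finType := ('I_(size s) * 'I_n)%type.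
Let N := #|U|.
Let grp (x : 'I_N) : mx := s`_(enum_val x).1.
Let crd (x : 'I_N) : 'I_n := (enum_val x).2.

(** Coordinates of [U] are pairs of a group element [h] and an index. [emb] is [x |-> (h x)_h],
    [ret] projects to the block [h = 1], and [permZ g] moves the block [h g] to the place [h]. *)
Let emb : 'M[K]_(N, n) := \matrix_(x, j) grp x (crd x) j.
Let ret : 'M[K]_(n, N) := \matrix_(j, x) ((grp x == 1%:M) && (crd x == j))%:R.
Let permZ (g : mx) : 'M[int]_N :=
  \matrix_(x, y) ((crd x == crd y) && (grp y == grp x *m g))%:R.
Let permK (g : mx) : 'M[K]_N := map_mx intr (permZ g).

Let us : uniq s. Proof. by case: gs. Qed.
Let s1 : 1%:M \in s. Proof. by case: gs => _ []. Qed.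
Let sM x y : x \in s -> y \in s -> x *m y \in s. Proof. by case: gs => _ [_ +] _; apply. Qed.
Let sV x : x \in s -> invmx x \in s. Proof. by case: gs => _ [_ _ +] xs => /(_ _ xs) []. Qed.
Let sU x : x \in s -> x \in unitmx. Proof. by case: gs => _ [_ _ +] xs => /(_ _ xs) []. Qed.

Let grp_in x : grp x \in s. Proof. exact: mem_nth. Qed.

Let sum_grp (A : nmodType) (F : mx -> 'I_n -> A) h j : h \in s ->
  \sum_x (if (crd x == j) && (grp x == h) then F (grp x) (crd x) else 0) = F h j.
Proof.
move=> hs; have lt : (index h s < size s)%N by rewrite index_mem.
pose x0 := enum_rank (Ordinal lt, j).
have g0 : grp x0 = h by rewrite /grp enum_rankK nth_index.
have c0 : crd x0 = j by rewrite /crd enum_rankK.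
rewrite (bigD1 x0) //= g0 c0 !eqxx big1 ?addr0 // => x ne.
case: ifP => // /andP[/eqP cx /eqP gx]; case/negP: ne; apply/eqP/enum_val_inj.
rewrite enum_rankK; move: cx gx; rewrite /crd /grp.
case: (enum_val x) => a b /= -> gx; congr (_, _); apply: val_inj => /=.
by rewrite -gx index_uniq.
Qed.

Let ret_emb : ret *m emb = 1%:M.
Proof.
apply/matrixP => i j; rewrite mxE -[RHS](sum_grp (fun g k => g k j) i s1).
by apply: eq_bigr => x _; rewrite !mxE andbC; case: ifP; rewrite ?mul1r ?mul0r.
Qed.

Let permK_emb g : g \in s -> permK g *m emb = emb *m g.
Proof.
move=> hg; apply/matrixP => x j.
have -> : (emb *m g) x j = (grp x *m g) (crd x) j.
  by rewrite !mxE; apply: eq_bigr => k _; rewrite mxE.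
rewrite -(sum_grp (fun g k => g k j) (crd x) (sM (grp_in x) hg)) mxE.
apply: eq_bigr => y _; rewrite !mxE [crd x == _]eq_sym.
by case: ifP; rewrite ?mul1r ?mul0r.
Qed.

Let permKT_emb g : g \in s -> (permK g)^T *m emb = emb *m invmx g.
Proof.
move=> hg; apply/matrixP => y j.
have -> : (emb *m invmx g) y j = (grp y *m invmx g) (crd y) j.
  by rewrite !mxE; apply: eq_bigr => k _; rewrite mxE.
rewrite -(sum_grp (fun g k => g k j) (crd y) (sM (grp_in y) (sV hg))) mxE.
apply: eq_bigr => x _; rewrite !mxE.
have -> : (grp y == grp x *m g) = (grp x == grp y *m invmx g).
  by apply/eqP/eqP => ->; rewrite ?mulmxK ?mulmxKV ?sU.
by case: ifP; rewrite ?mul1r ?mul0r.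
Qed.

Let orb m : {mpoly int[N]} := \sum_(g <- s) lsub (permZ g) 'X_[m].
Let toK : {mpoly int[N]} -> {mpoly K[N]} := map_mpoly intr.

Let toK_orb m : toK (orb m) = \sum_(g <- s) lsub (permK g) 'X_[m].
Proof.
rewrite /toK raddf_sum; apply: eq_bigr => g _.
by rewrite /= map_mpoly_lsub map_mpolyX.
Qed.

Let size_s : (size s)%:R != 0 :> K.
Proof.
have /pcharf0P -> := charK0.
by rewrite size_eq0; apply: contraTneq s1 => ->.
Qed.

(** An invariant symbol on [V] pulls back, through the transpose of [emb], to a symbol [P] invariant
    under the block permutations. Being its own average, [P] is a combination of orbit sums of
    nonconstant monomials, all of which annihilate [h]. *)
Let harmonic_restrict (h : {mpoly K[N]}) :
  (forall m, m != 0%MM -> pdiff (toK (orb m)) h = 0) -> dual_harmonic s (lsub emb h).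
Proof.
move=> hh p p0 pinv; rewrite pdiff_lsub; set P := lsub _ p.
have Pinv g : g \in s -> lsub (permK g) P = P.
  move=> hg; rewrite /P lsub_lsub -[permK g]trmxK -trmx_mul permKT_emb // trmx_mul.
  by rewrite -lsub_lsub pinv ?sV.
suff -> : pdiff P h = 0 by rewrite raddf0.
have sumP : (size s)%:R *: P = \sum_(k <- msupp P) P@_k *: toK (orb k).
  transitivity (\sum_(g <- s) lsub (permK g) P).
    rewrite (eq_big_seq (fun=> P)); last by move=> g /Pinv.
    by rewrite big_const_seq count_predT iter_addr_0 scaler_nat.
  transitivity (\sum_(g <- s) \sum_(k <- msupp P) P@_k *: lsub (permK g) 'X_[k]).
    apply: eq_bigr => g _; rewrite {1}[P]mpolyE linear_sum.
    by apply: eq_bigr => k _; rewrite linearZ.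
  rewrite exchange_big; apply: eq_bigr => k _.
  by rewrite toK_orb scaler_sumr.
rewrite -[LHS](scalerK size_s) -pdiffZl sumP pdiff_suml.
rewrite big_seq big1 ?scaler0 // => k Pk; rewrite pdiffZl hh ?scaler0 //.
apply: contraTneq Pk => ->.
by rewrite mcoeff_msupp negbK /P lsub_coeff0 p0.
Qed.

(** The retraction [ret] lifts [f] to [U], where monomials split over [int]; base change and
    restriction along [emb] bring the splitting back, since [ret *m emb] is the identity. *)
Lemma harmonic_decomposition d f : f \is d.-homog -> exists h : S,
  [/\ h \is d.-homog, dual_harmonic s h
    & prodspan (msize_below d) (group_invariant0 s) (f - h)].
Proof.
move=> hf; pose Q (F : {mpoly K[N]}) := exists h : S, [/\ h \is d.-homog, dual_harmonic s h
    & prodspan (msize_below d) (group_invariant0 s) (lsub emb F - h)].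
rewrite -[f]lsub1 -ret_emb -lsub_lsub.
have [P0 PD PZ] : lin_closed (prodspan (msize_below d) (group_invariant0 s)).
  by apply: prodspan_lin => c a; apply: msize_belowZ.
suff : Q (lsub ret f) by case=> h; exists h.
apply: (@mpoly_lin_ind _ _ Q) => [|F1 F2 [h1 [d1 H1 p1]] [h2 [d2 H2 p2]]|c F [h [dh H p]]|m].
- exists 0; split; [exact: rpred0 | by move=> p _ _; rewrite raddf0 |].
  by rewrite raddf0 subrr.
- exists (h1 + h2); split; first exact: rpredD.
    by move=> p p0 hp; rewrite raddfD /= H1 ?H2 ?addr0.
  by rewrite raddfD opprD addrACA; apply: PD.
- exists (c *: h); split; first exact: rpredZ.
    by move=> q q0 hq; rewrite pdiffZr H ?scaler0.
  by rewrite linearZ -scalerBr; apply: PZ.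
move/(dhomogP _ _ _ (lsub_homog ret hf)) => /= dm.
have orb_homog k : orb k \is (mdeg k).-homog.
  by apply: rpred_sum => g _; apply: lsub_homog; rewrite dhomogX.
have Xd : ('X_[m] : {mpoly int[N]}) \is d.-homog by rewrite dhomogX /= dm.
have [c [h [c0 hh hspan hann]]] := homog_decomposition orb_homog Xd.
(* The nonzero integer produced by the orthogonalisation stays invertible in characteristic 0. *)
have cK0 : c%:~R != 0 :> K.
  have /pcharf0P natK0 := charK0.
  case: c {hspan} c0 => k; first by move=> k0; rewrite -[_ *~ _]/(k%:R) natK0.
  by move=> _; change (- (k.+1%:R) != 0 :> K); rewrite oppr_eq0 natK0.
exists (c%:~R^-1 *: lsub emb (toK h)); split.
- by apply/rpredZ/lsub_homog/map_mpoly_homog.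
- move=> p p0 hp; rewrite pdiffZr (harmonic_restrict (h := toK h)) ?scaler0 //.
  by move=> k k0; rewrite -map_mpoly_pdiff hann ?raddf0.
rewrite -[lsub emb 'X_[m]](scalerK cK0) -scalerBr; apply: PZ.
have -> : c%:~R *: lsub emb 'X_[m] - lsub emb (toK h) = lsub emb (toK (c *: 'X_[m] - h)).
  by rewrite /toK !raddfB /= map_mpolyZ map_mpolyX linearZ.
pose phi := (lsub emb \o map_mpoly intr : {rmorphism {mpoly int[N]} -> S}).
apply: (prodspan_map (phi := phi)) hspan => [a ha|b [k k0 ->]].
  by apply/lsub_msize/map_mpoly_msize.
rewrite /phi /= -/(toK _) toK_orb raddf_sum /=; split; last first.
  rewrite raddf_sum big1 // => g _; rewrite /= !lsub_coeff0 mcoeffX (negbTE k0) //.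
(* [emb] intertwines the block permutation with [g], so an orbit sum on [U] restricts to an orbit
   sum on [V]. *)
suff -> : \sum_(g <- s) lsub emb (lsub (permK g) 'X_[k]) =
   \sum_(g <- s) lsub g (lsub emb 'X_[k]) by apply: sum_orbit_invariant.
rewrite !big_seq; apply: eq_bigr => g hg.
by rewrite !lsub_lsub permK_emb.
Qed.
End Decomposition.

(** * Divided differences *)

Section Harmonics.
Variables (K : fieldType) (charK0 : [pchar K] =i pred0) (n : nat).
Local Notation mx := 'M[K]_n.
Local Notation S := {mpoly K[n]}.
Implicit Types (s : seq mx) (g h : mx) (f p : S).

Lemma pairingXl_eq0 m f : (pairing 'X_[m] f == 0) = (f@_m == 0).
Proof.
have /pcharf0P natK0 := charK0.
rewrite pairingXl mulf_eq0 natK0 orbC; case: eqP => // /eqP.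
by rewrite -leqn0 leqNgt prodn_gt0 // => i; apply: fact_gt0.
Qed.

(** In characteristic 0, applying the operator to monomials recovers every coefficient of its
    symbol. *)
Lemma pdiff_inj p q : (forall f, pdiff p f = pdiff q f) -> p = q.
Proof.
move=> e; apply/eqP; rewrite -subr_eq0; apply/eqP/mpolyP => m; rewrite mcoeff0.
apply/eqP; rewrite -pairingXl_eq0 pairingC /pairing -scaleN1r pdiffDl pdiffZl e.
by rewrite scaleN1r subrr mcoeff0.
Qed.

Lemma actE g f : act g f = lsub (invmx g) f.
Proof. by rewrite lsubE. Qed.

Lemma invariant_dopP s (W : mx -> Prop) p : group_seq s -> (forall x, W x <-> x \in s) ->
  invariant_dop W p <-> forall g, g \in s -> lsub g^T p = p.
Proof.
move=> [_ [_ _ hV]] hW; split=> [hp g gs|hp g /hW gs f].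
  have [gu gV] := hV _ gs.
  apply: pdiff_inj => f; apply: (can_inj (g := lsub (invmx g)) (f := lsub g)).
    by move=> x; rewrite lsub_lsub mulmxV // lsub1.
  rewrite -pdiff_lsub; have /hW := gV => /hp /(_ f).
  by rewrite !actE invmxK.
have [_ gV] := hV _ gs.
by rewrite !actE [LHS]pdiff_lsub hp.
Qed.

Lemma harmonicP s (W : mx -> Prop) f : group_seq s -> (forall x, W x <-> x \in s) ->
  harmonic W f <-> dual_harmonic s f.
Proof.
move=> gs hW; split=> hf p p0 hp; apply: hf => //.
  by apply/(invariant_dopP _ gs hW).
by move/(invariant_dopP _ gs hW): hp.
Qed.

Lemma group_seq_trmx s : group_seq s -> group_seq [seq g^T | g <- s].
Proof.
move=> [us [s1 sM sV]]; split; first by rewrite map_inj_uniq //; apply: trmx_inj.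
split=> [|_ _ /mapP[x xs ->] /mapP[y ys ->]|_ /mapP[x xs ->]].
- by rewrite -trmx1 map_f.
- by rewrite -trmx_mul map_f // sM.
- by have [xu xV] := sV _ xs; rewrite unitmx_tr -trmx_inv map_f.
Qed.

Definition invideal s : S -> Prop := prodspan (fun _ => True) (group_invariant0 s).

Lemma invideal_lin s : lin_closed (invideal s).
Proof. exact: prodspan_lin. Qed.

(* The pairing of [f] with a monomial of top degree is computed by splitting
   the monomial into a harmonic and an ideal part for the contragredient group. *)
Lemma harmonic_top_notin_invideal s f i l d : group_seq s -> dual_harmonic s f ->
  msize f = d.+1 -> invideal s i -> (msize l <= d)%N -> f <> i + l.
Proof.
move=> gs hf df hi dl ef.
have f0 : f != 0 by rewrite -msize_poly_eq0 df.
have dm : mdeg (mlead f) = d by apply/eqP; rewrite -eqSS mlead_deg // df.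
have fm := mlead_supp f0; set m := mlead f in dm fm.
have Xm : ('X_[m] : S) \is d.-homog by rewrite dhomogX /= dm.
have [h [hh hharm hspan]] := harmonic_decomposition charK0 (group_seq_trmx gs) Xm.
have pair_inv0 (A : S -> Prop) t j k : (forall b, group_invariant0 t b -> pdiff b k = 0) ->
    prodspan A (group_invariant0 t) j -> pairing j k = 0.
  move=> hk; elim=> [|a b j' _ hb _ ih]; first by rewrite /pairing pdiff0l mcoeff0.
  by rewrite /pairing pdiffDl mcoeffD [X in _ + X]ih pdiff_mul hk // raddf0 mcoeff0 addr0.
(* In ['X_[m] = ('X_[m] - h) + h], the first part pairs to zero by harmonicity of [f]; [h] pairs to
   zero with [i] by its own harmonicity and with [l] by degree. *)
have : pairing 'X_[m] f = 0.
  rewrite -['X_[m]](subrK h) /pairing pdiffDl mcoeffD -!/(pairing _ _).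
  rewrite (pair_inv0 _ _ _ _ _ hspan) ?add0r; last first.
    by move=> b [hb b0]; apply: hf => // g hg; apply: hb; apply: map_f.
  rewrite pairingC ef /pairing pdiffDl mcoeffD -!/(pairing _ _).
  rewrite (pair_inv0 _ _ _ _ _ hi) ?add0r; last first.
    by move=> b [hb b0]; apply: hharm => // _ /mapP[g hg ->]; rewrite trmxK hb.
  rewrite pairingC pairingE big_seq big1 // => k hk.
  rewrite (memN_msupp_eq0 (p := l)) ?mulr0 ?mul0r //.
  by apply: msize_mdeg_ge; rewrite (dhomogP _ _ _ hh k hk).
by move/eqP; rewrite pairingXl_eq0 mcoeff_eq0 fm.
Qed.

(** Induction on degree: modulo harmonics, a monomial is a sum of products of an invariant with a
    cofactor of smaller degree, and the invariant factors are absorbed. *)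
Lemma invariants_times_harmonics s f : group_seq s ->
  prodspan (group_invariant s) (dual_harmonic s) f.
Proof.
move=> gs; have hlin : lin_closed (prodspan (group_invariant s) (dual_harmonic s)).
  by apply: prodspan_lin => c a ha g hg; rewrite linearZ /= ha.
have [h0 hD hZ] := hlin; move: {2}(msize f) (leqnn (msize f)) => d.
elim: d f => [|d ih] f hf.
  by move: hf; rewrite leqn0 msize_poly_eq0 => /eqP ->.
apply: mpoly_lin_ind => // m /msize_mdeg_lt fm.
have dm : (mdeg m <= d)%N by rewrite -ltnS (leq_trans fm).
have Xm : ('X_[m] : S) \is (mdeg m).-homog by rewrite dhomogX.
have [h [_ hh hs]] := harmonic_decomposition charK0 gs Xm.
rewrite -['X_[m]](subrK h); apply: (hD); last first.
  by rewrite -[h]mul1r; apply: prodspanM => // g _; rewrite rmorph1.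
elim: hs => // a b j ha [hb _] _; apply: hD; rewrite mulrC; apply: prodspan_mul.
  by move=> x hx g hg; rewrite rmorphM /= hb ?hx.
by apply: ih; apply: leq_trans ha dm.
Qed.

End Harmonics.

(** * Reflections and equations of their hyperplanes *)

Section Reflections.
Variables (K : fieldType) (n : nat).
Local Notation mx := 'M[K]_n.
Local Notation S := {mpoly K[n]}.
Implicit Types (g h : mx) (f p : S).

Lemma reflection_inv g : reflection g -> reflection (invmx g).
Proof.
move=> [gu rg]; split; first by rewrite unitmx_inv.
have -> : invmx g - 1%:M = - (invmx g *m (g - 1%:M)).
  by rewrite mulmxBr mulVmx // mulmx1 opprB.
by rewrite mxrank_opp eqmxMfull // row_full_unit unitmx_inv.
Qed.

Lemma reflection_conj g h : h \in unitmx -> reflection g ->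
  reflection (invmx h *m g *m h).
Proof.
move=> hu [gu rg]; split; first by rewrite !unitmx_mul unitmx_inv hu gu.
have -> : invmx h *m g *m h - 1%:M = invmx h *m (g - 1%:M) *m h.
  by rewrite mulmxBr mulmx1 mulmxBl mulVmx.
by rewrite mxrankMfree ?row_free_unit // eqmxMfull // row_full_unit unitmx_inv.
Qed.

(** For a reflection [g], [L] is an equation of its hyperplane; the last clause makes the divided
    difference of [f] a polynomial. *)
Definition root_form g (L : S) : Prop :=
  [/\ L != 0, L \is 1.-homog, forall v, evalv L v = 0 -> g *m v = v
    & forall f, exists q, lsub g f - f = L * q].

(** [g - 1] has rank one, so its rows are multiples of one nonzero row, whose linear form is [L]. *)
Lemma root_form_exists g : reflection g -> exists L, root_form g L.
Proof.
move=> [gu rg]; have [B eB] : exists B, B = g - 1%:M by exists (g - 1%:M).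
rewrite -eB in rg; have eg : g = B + 1%:M by rewrite eB subrK.
have [i0 Bi0] : exists i, row i B != 0.
  apply/existsP; apply: contra_eqT rg; rewrite negb_exists => /forallP h.
  suff -> : B = 0 by rewrite mxrank0.
  by apply/row_matrixP => i; rewrite row0; apply/eqP; rewrite -[_ == _]negbK.
have colin i : (row i B <= row i0 B)%MS.
  apply: submx_trans (row_sub i B) _.
  by rewrite -(mxrank_leqif_sup (row_sub i0 B)) rg rank_rV Bi0.
have {colin} colin i : exists a, forall j, B i j = a * B i0 j.
  have /sub_rVP[a ea] := colin i; exists a => j.
  by have /rowP/(_ j) := ea; rewrite !mxE.
pose L : S := \sum_j B i0 j *: 'X_j.
have Lcoef j : L@_U_(j) = B i0 j.
  rewrite raddf_sum (bigD1 j) //= mcoeffZ mcoeffXU eqxx mulr1.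
  by rewrite big1 ?addr0 // => k ne; rewrite mcoeffZ mcoeffXU (negbTE ne) mulr0.
exists L; split.
- apply: contraNneq Bi0 => L0; apply/eqP/rowP => j.
  by rewrite !mxE -Lcoef L0 mcoeff0.
- by apply: rpred_sum => j _; rewrite rpredZ // dhomogX /= mdeg1.
- move=> v Lv; rewrite eg mulmxDl mul1mx; suff -> : B *m v = 0 by rewrite add0r.
  have Bv : (B *m v) i0 ord0 = 0.
    rewrite -[RHS]Lv /evalv raddf_sum mxE; apply: eq_bigr => j _.
    by rewrite /= mevalZ mevalXU.
  apply/colP => i; have [a ea] := colin i; rewrite [RHS]mxE -(mulr0 a) -Bv !mxE.
  by rewrite mulr_sumr; apply: eq_bigr => j _; rewrite ea mulrA.
elim/mpoly_alg_ind => [c|i|f1 f2 [q1 e1] [q2 e2]|f1 f2 [q1 e1] [q2 e2]].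
- by exists 0; rewrite lsubC subrr mulr0.
- have [a ea] := colin i; exists a%:MP.
  rewrite lsubX eg mulrC mul_mpolyC scaler_sumr.
  rewrite (eq_bigr (fun j => a *: (B i0 j *: 'X_j) + (i == j)%:R *: 'X_j)); last first.
    by move=> j _; rewrite !mxE ea scalerDl scalerA.
  rewrite big_split /= [X in _ + X - _](bigD1 i) //= eqxx scale1r.
  rewrite [X in _ + (_ + X) - _]big1 ?addr0 ?addrK // => j ne.
  by rewrite eq_sym (negbTE ne) scale0r.
- by exists (q1 + q2); rewrite raddfD /= mulrDr -e1 -e2 opprD addrACA.
(* Twisted Leibniz rule: [g(f1 f2) - f1 f2 = (g f1 - f1) (g f2) + f1 (g f2 - f2)]. *)
- exists (q1 * lsub g f2 + f1 * q2).
  rewrite rmorphM /= mulrDr [L * (f1 * _)]mulrCA mulrA -e1 -e2.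
  by rewrite mulrBl mulrBr addrA subrK.
Qed.

Lemma root_form_msize g L f q d : root_form g L -> (msize f <= d.+1)%N ->
  lsub g f - f = L * q -> (msize q <= d)%N.
Proof.
move=> [L0 Lh _ _] hf e; have [->|q0] := eqVneq q 0; first by rewrite msize0.
have : (msize (L * q) <= d.+1)%N.
  rewrite -e (leq_trans (msizeD_le _ _)) // geq_max msizeN hf andbT.
  exact: lsub_msize.
suff -> : msize (L * q) = (msize q).+1 by [].
rewrite msizeM //; have [/= m mL] : exists m, m \in msupp L.
  by exists (mlead L); apply: mlead_supp.
have hL : (1 < msize L)%N.
  by have := msize_mdeg_lt mL; rewrite (dhomogP _ _ _ Lh m mL).
have hL2 := msize_homog Lh.
have -> : msize L = 2%N by apply/eqP; rewrite eqn_leq hL2.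
by [].
Qed.

End Reflections.

(** * Chevalley's averaging modulo the invariant ideal and lower degree *)

Section Descent.
Variables (K : fieldType) (charK0 : [pchar K] =i pred0) (n : nat).
Local Notation mx := 'M[K]_n.
Local Notation S := {mpoly K[n]}.
Variables (s : seq mx) (gs : group_seq s).
Hypothesis s_gen : forall x, x \in s -> gen (fun r => r \in s /\ reflection r) x.

Definition invideal_mod d (f : S) : Prop :=
  exists i l, [/\ invideal s i, (msize l <= d)%N & f = i + l].

Lemma invideal_mod_lin d : lin_closed (invideal_mod d).
Proof.
have [I0 ID IZ] := invideal_lin s.
split=> [|x y [i [l [hi hl ->]]] [i' [l' [hi' hl' ->]]]|c x [i [l [hi hl ->]]]].
- by exists 0, 0; rewrite msize0 addr0.
- exists (i + i'), (l + l'); split; [exact: ID | | by rewrite addrACA].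
  by rewrite (leq_trans (msizeD_le _ _)) // geq_max hl.
- exists (c *: i), (c *: l); split; [exact: IZ | | by rewrite scalerDr].
  exact: leq_trans (msizeZ_le _ _) hl.
Qed.

Lemma invideal_mod_lsub d h f : h \in s -> invideal_mod d f -> invideal_mod d (lsub h f).
Proof.
move=> hs [i [l [hi hl ->]]]; exists (lsub h i), (lsub h l); split.
- apply: (prodspan_map (phi := lsub h)) hi => // b [hb b0].
  by rewrite /= hb.
- exact: lsub_msize.
- exact: raddfD.
Qed.

(** Congruence of [f] with its translates passes from reflections to the whole group, so [f] is
    congruent to its average. The average minus its constant term is in the ideal, and [0 < d]
    absorbs the constant. *)
Lemma invideal_mod_descent d f : (0 < d)%N ->
  (forall r, r \in s -> reflection r -> invideal_mod d (lsub r f - f)) -> invideal_mod d f.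
Proof.
move=> d0 hr; have [I0 ID IZ] := invideal_mod_lin d.
have hg g : g \in s -> invideal_mod d (lsub g f - f).
  move=> /s_gen [t [ht ->]].
  suff [] : foldr (fun a b => a *m b) 1%:M t \in s /\
    invideal_mod d (lsub (foldr (fun a b => a *m b) 1%:M t) f - f) by [].
  have [_ [s1 sM sV]] := gs.
  elim: t ht => [|y t ih] ht /=; first by rewrite lsub1 subrr.
  have [ys ry] : y \in s /\ reflection y.
    have [//|[ys ry]] := ht y (mem_head _ _).
    by rewrite -(invmxK y); split; [case: (sV _ ys) | apply: reflection_inv].
  have [xs hx] := ih (fun z zt => ht z (mem_behead (s := y :: t) zt)).
  split; first exact: sM.
  (* Telescoping: with [x] the product of [t], [lsub (y *m x) f - f] is [lsub x (lsub y f - f)] plus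
     [lsub x f - f]. *)
  rewrite -lsub_lsub -(subrK (lsub (foldr (fun a b => a *m b) 1%:M t) f) (lsub _ (lsub _ _))).
  rewrite -raddfB -addrA; apply: (ID) => //.
  by apply: invideal_mod_lsub => //; apply: hr.
have /pcharf0P natK0 := charK0.
have [_ [s1 _ _]] := gs.
have s0 : (size s)%:R != 0 :> K.
  by rewrite natK0 size_eq0; apply: contraTneq s1 => ->.
rewrite -(scalerK s0 f); apply: (IZ).
pose b := \sum_(g <- s) lsub g f.
have b_inv : group_invariant s b by apply: sum_orbit_invariant.
have -> : (size s)%:R *: f = - (\sum_(g <- s) (lsub g f - f)) + (b - (b@_0)%:MP) + (b@_0)%:MP.
  rewrite -addrA subrK sumrB opprB big_const_seq count_predT iter_addr_0.
  by rewrite subrK scaler_nat.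
apply: (ID); first apply: (ID).
- rewrite -scaleN1r big_seq; apply: (IZ).
  by apply: (lin_closed_sum (P := invideal_mod d)) => //; apply: invideal_mod_lin.
- exists (b - (b@_0)%:MP), 0; rewrite msize0 addr0; split=> //.
  rewrite -[X in invideal s X]mul1r; apply: prodspanM => //; split.
    by move=> g gin; rewrite raddfB /= b_inv // lsubC.
  by rewrite mcoeffB mcoeffC eqxx mulr1 subrr.
- exists 0, (b@_0)%:MP; rewrite add0r; split=> //; first exact: Prodspan0.
  by rewrite mmeasureC; apply: leq_trans d0; case: (_ != 0).
Qed.

End Descent.

(** * The ideal generated by the invariants vanishing at a fixed point *)

Section LocalIdeal.
Variables (K : fieldType) (n : nat).
Local Notation mx := 'M[K]_n.
Local Notation S := {mpoly K[n]}.
Variables (w : seq mx) (gw : group_seq w) (v : 'cV[K]_n).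
Hypothesis w_fix : forall g, g \in w -> g *m v = v.

Definition local_ideal : S -> Prop :=
  prodspan (fun _ => True) (fun b => group_invariant w b /\ evalv b v = 0).

Lemma local_ideal_lin : lin_closed local_ideal.
Proof. exact: prodspan_lin. Qed.

Lemma evalv_lsub (g : mx) (f : S) u : evalv (lsub g f) u = evalv f (g *m u).
Proof. exact: lsub_eval. Qed.

Lemma evalvM (f g : S) u : evalv (f * g) u = evalv f u * evalv g u.
Proof. exact: mevalM. Qed.

Lemma evalvB (f g : S) u : evalv (f - g) u = evalv f u - evalv g u.
Proof. exact: mevalB. Qed.

Lemma evalvD (f g : S) u : evalv (f + g) u = evalv f u + evalv g u.
Proof. exact: mevalD. Qed.

Lemma evalvZ c (f : S) u : evalv (c *: f) u = c * evalv f u.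
Proof. exact: mevalZ. Qed.

Lemma evalvC c u : evalv (c%:MP : S) u = c.
Proof. exact: mevalC. Qed.

Lemma local_ideal_eval f : local_ideal f -> evalv f v = 0.
Proof.
elim=> [|a b j _ [_ bv] _ ih]; first exact: meval0.
by rewrite evalvD evalvM bv mulr0 ih addr0.
Qed.

(** The norm [N] of [u] over [w] is an invariant multiple of [u], with value [u(v)^|w|] at [v];
    modulo the ideal it acts as that nonzero scalar. *)
Lemma local_ideal_cancel u z : evalv u v != 0 -> local_ideal (u * z) -> local_ideal z.
Proof.
move=> uv hz; have [_ ID IZ] := local_ideal_lin.
have [uw [w1 _ _]] := gw.
pose N := \prod_(g <- w) lsub g u.
have N_inv : group_invariant w N.
  move=> h hw; rewrite rmorph_prod /= -[in RHS]/N /N.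
  rewrite -[in RHS](perm_big _ (group_seq_permr gw hw)) big_map.
  by apply: eq_bigr => g _; rewrite lsub_lsub.
have Nv : evalv N v = evalv u v ^+ size w.
  rewrite /evalv rmorph_prod /= big_seq (eq_bigr (fun=> evalv u v)).
    by rewrite -big_seq big_const_seq count_predT iter_mulr_1.
  by move=> g hg; rewrite -!/(evalv _ _) evalv_lsub w_fix.
have c0 : evalv N v != 0 by rewrite Nv expf_neq0.
rewrite -(scalerK c0 z); apply: IZ.
have -> : evalv N v *: z = N * z - z * (N - (evalv N v)%:MP).
  by rewrite mulrBr [N * z]mulrC opprB addrC subrK mulrC mul_mpolyC.
apply: (lin_closedB local_ideal_lin).
  rewrite /N (big_rem 1%:M) //= lsub1 [u * _]mulrC -mulrA.
  exact: prodspan_mul.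
apply: prodspanM => //; split; last by rewrite evalvB evalvC subrr.
by move=> g hg; rewrite raddfB /= lsubC N_inv.
Qed.

End LocalIdeal.

(** * Divided differences on the orbit ideal and vanishing of its harmonics *)

Section Injectivity.
Variables (K : fieldType) (charK0 : [pchar K] =i pred0) (n : nat).
Local Notation mx := 'M[K]_n.
Local Notation S := {mpoly K[n]}.
Variables (s : seq mx) (gs : group_seq s).
Hypothesis s_gen : forall x, x \in s -> gen (fun r => r \in s /\ reflection r) x.
Variables (w : seq mx) (gw : group_seq w) (v : 'cV[K]_n).
Hypothesis w_fix : forall g, g \in w -> g *m v = v.
Hypothesis w_refl : forall r, r \in s -> reflection r -> r *m v = v -> r \in w.

Definition orbit_ideal (f : S) : Prop := forall g, g \in s -> local_ideal w v (lsub g f).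

(** If [lsub g L] does not vanish at [v], it can be cancelled. Otherwise the conjugate of [r] by [g]
    fixes [v], hence lies in [w] and fixes the generators, so its divided difference acts only on
    their cofactors. *)
Lemma orbit_ideal_divided_difference r L f q : r \in s -> reflection r ->
  root_form r L -> lsub r f - f = L * q -> orbit_ideal f -> orbit_ideal q.
Proof.
move=> rs rr [L0 _ Lv Lq] e hf g hg; have [us [s1 sM sV]] := gs.
have [gu gV] := sV _ hg.
have eg : lsub (r *m g) f - lsub g f = lsub g L * lsub g q.
  by rewrite -lsub_lsub -raddfB /= e rmorphM.
have [Lgv|Lgv] := eqVneq (evalv (lsub g L) v) 0; last first.
  apply: (local_ideal_cancel gw w_fix Lgv); rewrite -eg.
  by apply: (lin_closedB (local_ideal_lin _ _)); apply: hf => //; apply: sM.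
set t := invmx g *m r *m g.
have tw : t \in w.
  apply: w_refl; [by rewrite !sM | exact: reflection_conj |].
  by rewrite -!mulmxA Lv -?evalv_lsub // mulmxA mulVmx // mul1mx.
have Lg0 : lsub g L != 0.
  apply: contraNneq L0 => Lg0; rewrite -[L]lsub1 -(mulmxV gu) -lsub_lsub Lg0.
  by rewrite raddf0.
have [z hz ez] : exists2 z, local_ideal w v z & lsub t (lsub g f) - lsub g f = lsub g L * z.
  elim: (hf _ hg) => [|a b j _ [hb bv] _ [z hz ez]].
    by exists 0; [exact: Prodspan0 | rewrite raddf0 subrr mulr0].
  have [y ey] := Lq (lsub (invmx g) a).
  have {}ey : lsub t a - a = lsub g L * lsub g y.
    rewrite -rmorphM -ey raddfB /= !lsub_lsub mulVmx // lsub1.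
    by rewrite /t mulmxA.
  exists (lsub g y * b + z); first exact: ProdspanD.
  rewrite raddfD /= rmorphM /= hb // opprD addrACA ez mulrDr -mulrBl ey.
  by rewrite mulrA.
suff -> : lsub g q = z by [].
apply: (mulfI Lg0); rewrite -ez -eg; congr (_ - _).
by rewrite lsub_lsub /t !mulmxA mulmxV // mul1mx.
Qed.

(** Divided differences lower the degree and preserve the orbit ideal. By induction and averaging,
    its members agree with elements of the invariant ideal up to lower degree, which a nonzero
    harmonic cannot do. *)
Lemma harmonic_orbit_ideal_eq0 f : dual_harmonic s f -> orbit_ideal f -> f = 0.
Proof.
move=> hf qf; apply/eqP; rewrite -msize_poly_eq0; apply/negPn/negP => f0.
have [d df] : exists d, msize f = d.+1 by case: (msize f) f0 => // d _; exists d.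
suff [i [l [hi hl e]]] : invideal_mod s d f.
  exact: (harmonic_top_notin_invideal charK0 gs hf df hi hl e).
(* Harmonicity is dropped here: the induction runs over all members of the orbit ideal of degree at
   most [d]. *)
have {hf f0} df : (msize f <= d.+1)%N by rewrite df.
elim: d f qf df => [|d ih] f qf.
  move/msize1_polyC => ef; exists 0, 0; rewrite msize0 addr0; split=> //.
    exact: Prodspan0.
  have [_ [s1 _ _]] := gs; have := local_ideal_eval (qf _ s1).
  by rewrite lsub1 ef evalvC => ->.
move=> df; apply: invideal_mod_descent => // r rs rr.
have [L hL] := root_form_exists rr; have [L0 Lh _ Lq] := hL.
have [q e] := Lq f; rewrite e.
have [i [l [hi hl ->]]] : invideal_mod s d q.
  apply: ih; first exact: orbit_ideal_divided_difference hL e qf.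
  exact: root_form_msize hL df e.
exists (L * i), (L * l); rewrite mulrDr; split=> //.
  exact: prodspan_mul.
have [->|l0] := eqVneq l 0; first by rewrite mulr0 msize0.
rewrite msizeM //; apply: leq_trans (_ : (2 + d).-1 <= d.+1)%N => //.
by rewrite -!subn1 leq_sub2r // leq_add // (msize_homog Lh).
Qed.

End Injectivity.

(** * Generated groups, free points and twisted actions *)

Section Generation.
Variables (K : fieldType) (n : nat).
Local Notation mx := 'M[K]_n.
Implicit Types (X Y G : mx -> Prop) (x y g : mx).

Lemma invmx_mul x y : x \in unitmx -> y \in unitmx ->
  invmx (x *m y) = invmx y *m invmx x.
Proof.
move=> xu yu; have xyu : x *m y \in unitmx by rewrite unitmx_mul xu.
rewrite -[RHS](mulKmx xyu); suff -> : x *m y *m (invmx y *m invmx x) = 1%:M.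
  by rewrite mulmx1.
by rewrite mulmxA mulmxK // mulmxV.
Qed.

Lemma gen_ind X (P : mx -> Prop) : P 1%:M ->
  (forall y x, X y \/ X (invmx y) -> P x -> P (y *m x)) -> forall x, gen X x -> P x.
Proof.
move=> P1 PM _ [t [ht ->]]; elim: t ht => //= y t ih ht.
apply: PM; first by apply: ht; rewrite mem_head.
by apply: ih => z zt; apply: ht; rewrite inE zt orbT.
Qed.

Lemma gen1 X : gen X 1%:M.
Proof. by exists [::]. Qed.

Lemma gen_step X y x : X y \/ X (invmx y) -> gen X x -> gen X (y *m x).
Proof.
move=> hy [t [ht ->]]; exists (y :: t); split=> // z.
by rewrite inE => /orP[/eqP -> //|]; apply: ht.
Qed.

Lemma gen_incl X x : X x -> gen X x.
Proof. by move=> hx; rewrite -[x]mulmx1; apply: gen_step; [left | apply: gen1]. Qed.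

Lemma gen_mul X x y : gen X x -> gen X y -> gen X (x *m y).
Proof.
move=> hx hy; move: x hx; apply: gen_ind => [|z x hz ih]; first by rewrite mul1mx.
by rewrite -mulmxA; apply: gen_step.
Qed.

Lemma gen_mono X Y x : (forall y, X y -> Y y) -> gen X x -> gen Y x.
Proof.
move=> h; move: x; apply: gen_ind => [|y x [/h hy|/h hy]]; first exact: gen1.
  by apply: gen_step; left.
by apply: gen_step; right.
Qed.

Lemma is_group_gen X : (forall x, X x -> x \in unitmx) -> is_group (gen X).
Proof.
move=> Xu; split; [exact: gen1 | exact: gen_mul |].
have yu y : X y \/ X (invmx y) -> y \in unitmx.
  by case=> /Xu; rewrite ?unitmx_inv.
apply: gen_ind => [|y x hy [xu hx]].
  by rewrite unitmx1 invmx1; split=> //; apply: gen1.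
have hyu := yu _ hy; rewrite unitmx_mul hyu xu invmx_mul //; split=> //.
apply: gen_mul hx _; rewrite -[invmx y]mulmx1; apply: gen_step (gen1 X).
by rewrite invmxK; case: hy; [right | left].
Qed.

Lemma gen_sub_group X G x : is_group G -> (forall y, X y -> G y) -> gen X x -> G x.
Proof.
move=> [G1 GM GV] h; move: x; apply: gen_ind => // y x hy hx; apply: GM => //.
by case: hy => [/h //|/h /GV []]; rewrite invmxK.
Qed.

(** The predicate [G] carries no decision procedure, so excluded middle filters the list [s0]. *)
Lemma group_seq_exists G (s0 : seq mx) : is_group G -> (forall x, G x -> x \in s0) ->
  exists s, group_seq s /\ forall x, G x <-> x \in s.
Proof.
move=> gG Gs0.
have [s1 hs1] : exists s1 : seq mx, forall x, x \in s1 <-> x \in s0 /\ G x.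
  elim: s0 {Gs0} => [|y s0 [s1 ih]]; first by exists [::] => x; split=> // [[]].
  have [Gy|nGy] := classic (G y); [exists (y :: s1) | exists s1] => x.
    rewrite !inE; split=> [/orP[/eqP ->|/ih[-> ?]]|[/orP[->//|xs Gx]]].
    - by rewrite eqxx.
    - by rewrite orbT.
    - by apply/orP; right; apply/ih.
  rewrite inE; split=> [/ih[-> ?]|[/orP[/eqP ->//|xs Gx]]]; first by rewrite orbT.
  by apply/ih.
have hs x : G x <-> x \in undup s1.
  by rewrite mem_undup; split=> [Gx|/hs1[]//]; apply/hs1; split=> //; apply: Gs0.
exists (undup s1); split=> //; split; first exact: undup_uniq.
case: gG => G1 GM GV; split=> [|x y /hs Gx /hs Gy|x /hs Gx]; first exact/hs.
  by apply/hs/GM.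
by have [xu /hs xV] := GV x Gx.
Qed.

Lemma Gv_fix G v g : Gv G v g -> g *m v = v.
Proof.
move: g; apply: gen_ind => [|y x hy xv]; first by rewrite mul1mx.
rewrite -mulmxA xv; case: hy => [[_ _ //]|[_ [yu _] yv]].
by rewrite -[in LHS]yv mulmxA mulmxV ?mul1mx // -unitmx_inv.
Qed.

(** Fixing [v] and fixing a nonzero multiple of [v] are the same, so conjugation by [h] sends
    generating reflections to generating reflections. *)
Lemma Gv_conj G (v : 'cV[K]_n) h c : h \in unitmx -> c != 0 -> h *m v = c *: v ->
  (forall x, G x -> G (h *m x *m invmx h)) ->
  forall x, Gv G v x -> Gv G v (h *m x *m invmx h).
Proof.
move=> hu c0 hv hG.
have hV : invmx h *m v = c^-1 *: v.
  by rewrite -[v in LHS](scalerK c0) -hv -scalemxAr mulKmx.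
pose X r := [/\ G r, reflection r & r *m v = v].
have XJ z : X z -> X (h *m z *m invmx h).
  move=> [Gz rz zv]; split; first exact: hG.
    by rewrite -[X in X *m z](invmxK h); apply: reflection_conj; rewrite ?unitmx_inv.
  by rewrite -!mulmxA hV -!scalemxAr zv hv scalerA mulVf ?scale1r.
apply: gen_ind => [|y x hy ih]; first by rewrite mulmx1 mulmxV //; apply: gen1.
have -> : h *m (y *m x) *m invmx h = (h *m y *m invmx h) *m (h *m x *m invmx h).
  by rewrite !mulmxA mulmxKV.
apply: gen_step ih; case: hy => hy; [left; exact: XJ | right].
have yu : y \in unitmx by rewrite -unitmx_inv; case: hy => _ [].
suff -> : invmx (h *m y *m invmx h) = h *m invmx y *m invmx h by apply: XJ.
by rewrite !invmx_mul ?unitmx_mul ?unitmx_inv ?hu // invmxK mulmxA.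
Qed.

End Generation.

(** * Points with trivial stabiliser and interpolation on their orbits *)

Section FreePoint.
Variables (K : fieldType) (charK0 : [pchar K] =i pred0) (n : nat).
Local Notation mx := 'M[K]_n.
Local Notation S := {mpoly K[n]}.

Lemma natr_inj_pchar0 : injective (fun k : nat => k%:R : K).
Proof.
have /pcharf0P natK0 := charK0.
move=> k l; wlog le : k l / (k <= l)%N => [h e|e].
  by case: (leqP k l) => [/h|/ltnW /h h']; [apply | rewrite h'].
have : (l - k)%:R == 0 :> K by rewrite natrB // e subrr.
by rewrite natK0 subn_eq0 => kl; apply/eqP; rewrite eqn_leq le.
Qed.

Lemma nonroot_exists (p : {poly K}) : p != 0 -> exists t, p.[t] != 0.
Proof.
move=> p0; pose rs := [seq (k%:R : K) | k <- iota 0 (size p)].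
have /allPn[t _ ht] : ~~ all (root p) rs; last by exists t.
apply/negP => hall; have := max_poly_roots p0 hall.
rewrite map_inj_uniq ?iota_uniq; last exact: natr_inj_pchar0.
by move=> /(_ isT); rewrite size_map size_iota ltnn.
Qed.

(* A generic point of the moment curve lies on none of finitely many proper subspaces. *)
Lemma free_point (s : seq mx) : exists u : 'cV[K]_n, forall g, g \in s -> g *m u = u -> g = 1%:M.
Proof.
pose c t : 'cV[K]_n := \col_i t ^+ i.
suff [P P0 hP] : exists2 P : {poly K}, P != 0 &
    forall t, P.[t] != 0 -> forall g, g \in s -> g *m c t = c t -> g = 1%:M.
  by have [t ht] := nonroot_exists P0; exists (c t); apply: hP.
elim: s => [|g s [P P0 hP]]; first by exists 1; rewrite ?oner_neq0.
have [g1|g1] := eqVneq g 1%:M.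
  by exists P => // t ht h; rewrite inE => /orP[/eqP -> //|]; apply: hP.
have [i [j ij]] : exists i j, (g - 1%:M) i j != 0.
  have : ~~ [forall i, forall j, (g - 1%:M) i j == 0].
    apply: contraNN g1 => /forallP h; rewrite -subr_eq0; apply/eqP/matrixP => i j.
    by rewrite [RHS]mxE; have /forallP/(_ j)/eqP := h i.
  by rewrite negb_forall => /existsP[i]; rewrite negb_forall => /existsP[j]; exists i, j.
(* [q.[t]] is the [i]-th coordinate of [(g - 1) c(t)]; the nonzero entry at [i], [j] makes [q]
   nonzero. *)
pose q : {poly K} := \sum_k (g - 1%:M) i k *: 'X^k.
have q0 : q != 0.
  apply: contraNneq ij => q0; have : q`_j = 0 by rewrite q0 coef0.
  rewrite coef_sum (bigD1 j) //= big1 => [|k ne]; rewrite coefZ coefXn ?eqxx ?mulr1 ?addr0.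
    by move=> ->.
  by rewrite eq_sym -[_ == _ :> nat]/(k == j) (negbTE ne) mulr0.
exists (q * P) => [|t]; first by rewrite mulf_neq0.
rewrite hornerM mulf_eq0 negb_or => /andP[qt Pt] h; rewrite inE => /orP[/eqP ->|]; last exact: hP.
move=> e; case/negP: qt; apply/eqP; rewrite horner_sum.
transitivity (((g - 1%:M) *m c t) i ord0); last by rewrite mulmxBl mul1mx e subrr mxE.
by rewrite mxE; apply: eq_bigr => k _; rewrite hornerZ hornerXn !mxE.
Qed.

Lemma separating_poly (u : 'cV[K]_n) (t : seq 'cV[K]_n) : u \notin t ->
  exists e : S, evalv e u = 1 /\ forall q, q \in t -> evalv e q = 0.
Proof.
elim: t => [|q t ih]; first by exists 1; split=> //; apply: meval1.
rewrite inE negb_or => /andP[uq /ih[e [eu et]]].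
have [i qi] : exists i, u i ord0 - q i ord0 != 0.
  apply/existsP; rewrite -negb_forall; apply: contraNN uq => /forallP h.
  by apply/eqP/colP => i; apply/eqP; rewrite -subr_eq0 h.
pose l : S := (u i ord0 - q i ord0)^-1 *: ('X_i - (q i ord0)%:MP).
have lE x : evalv l x = (u i ord0 - q i ord0)^-1 * (x i ord0 - q i ord0).
  by rewrite evalvZ evalvB evalvC /evalv mevalXU.
exists (l * e); split; first by rewrite evalvM lE mulVf // mul1r.
move=> x; rewrite inE evalvM => /orP[/eqP ->|/et ->]; last by rewrite mulr0.
by rewrite lE subrr mulr0 mul0r.
Qed.

(** Invariants are constant on the orbit of [u], so in a separating polynomial they may be replaced
    by their values, which leaves a harmonic. *)
Lemma harmonic_separating (s : seq mx) (u : 'cV[K]_n) : group_seq s ->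
  (forall g, g \in s -> g *m u = u -> g = 1%:M) ->
  exists h : S, dual_harmonic s h /\
    forall g, g \in s -> evalv (lsub g h) u = (g == 1%:M)%:R.
Proof.
move=> gs hu.
have [|e [eu et]] := @separating_poly u [seq g *m u | g <- s & g != 1%:M].
  apply/negP => /mapP[g]; rewrite mem_filter => /andP[g1 gin] /esym /hu ge.
  by rewrite ge ?eqxx in g1.
have [h hh he] : exists2 h : S, dual_harmonic s h &
    forall g, g \in s -> evalv (lsub g h) u = evalv (lsub g e) u.
  elim: (invariants_times_harmonics charK0 e gs) => [|a b f ha hb _ [h hh he]].
    by exists 0 => // p _ _; rewrite raddf0.
  exists (evalv a u *: b + h) => [p p0 hp|g gin].
    by rewrite raddfD /= pdiffZr /= hb // hh // scaler0 addr0.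
  by rewrite !raddfD /= linearZ /= rmorphM /= !evalvD evalvZ evalvM ha // he.
exists h; split=> // g gin; rewrite he // evalv_lsub.
have [->|g1] := eqVneq g 1%:M; first by rewrite mul1mx eu.
by rewrite et //; apply/mapP; exists g; rewrite ?mem_filter ?g1.
Qed.

End FreePoint.

(** Both sides multiply degree [i] by [c^i]; the graded twist thus becomes substitution by a scalar
    matrix. *)
Lemma twp_lsub (K : fieldType) n (c : K) (f : {mpoly K[n]}) : twp c f = lsub c%:M f.
Proof.
rewrite {2}[f]mpolyE linear_sum /twp; apply: eq_bigr => m _.
rewrite linearZ /= mulrC -scalerA; congr (_ *: _).
rewrite mpolyXE_id rmorph_prod /= mdegE -prodrXr -scaler_prod.
apply: eq_bigr => i _; rewrite rmorphXn /= -exprZn; congr (_ ^+ _).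
rewrite lsubX (bigD1 i) //= big1 => [|j ne]; rewrite mxE ?eqxx ?addr0 //.
by rewrite eq_sym (negbTE ne) mulr0n scale0r.
Qed.

(** * Plain and twisted actions on tuples of polynomials *)

Section Tensor.
Variables (K : fieldType) (n d : nat).
Local Notation mx := 'M[K]_n.
Local Notation S := {mpoly K[n]}.
Implicit Types (R : 'M[K]_d) (A : mx) (F : 'I_d -> S).

(** A common form for [tact] and [twact]: [R] acts on [M] and [A] on polynomials, so that
    composition reduces to matrix products. *)
Definition tensor_map R A F : 'I_d -> S := fun i => \sum_j R i j *: lsub A (F j).

Lemma tensor_map_comp R R' A A' F :
  tensor_map R A (tensor_map R' A' F) = tensor_map (R *m R') (A' *m A) F.
Proof.
apply: functional_extensionality => i; rewrite /tensor_map.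
transitivity (\sum_j \sum_k (R i j * R' j k) *: lsub (A' *m A) (F k)).
  apply: eq_bigr => j _; rewrite [lsub A _]linear_sum scaler_sumr; apply: eq_bigr => k _.
  by rewrite linearZ /= lsub_lsub scalerA.
rewrite exchange_big; apply: eq_bigr => k _.
by rewrite mxE scaler_suml.
Qed.

Lemma tensor_map1l A F : tensor_map 1%:M A F = fun i => lsub A (F i).
Proof.
apply: functional_extensionality => i; rewrite /tensor_map (bigD1 i) //= big1 => [|j ne].
  by rewrite mxE eqxx scale1r addr0.
by rewrite mxE eq_sym (negbTE ne) scale0r.
Qed.

Lemma tact_tensor_map rho g F : tact rho g F = tensor_map (rho g) (invmx g) F.
Proof.
by apply: functional_extensionality => i; apply: eq_bigr => j _; rewrite actE.
Qed.

Lemma twact_tensor_map rho theta g F :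
  twact rho theta g F = tensor_map (rho g) (invmx g *m (theta g)%:M) F.
Proof.
apply: functional_extensionality => i; rewrite /twact twp_lsub linear_sum.
by apply: eq_bigr => j _; rewrite linearZ /= actE lsub_lsub.
Qed.

End Tensor.

(** * Substitutions by matrices normalising a group *)

Section Normalizing.
Variables (K : fieldType) (n : nat).
Local Notation mx := 'M[K]_n.
Local Notation S := {mpoly K[n]}.
Implicit Types (s : seq mx) (A g : mx) (f : S).

(** One direction of conjugation serves invariants, the other harmonics, whose symbols transform by
    the transpose. *)
Definition normalizes A s : Prop := A \in unitmx /\
  forall g, g \in s -> A *m g *m invmx A \in s /\ invmx A *m g *m A \in s.

Lemma normalizes_mem A s : group_seq s -> A \in s -> normalizes A s.
Proof.
move=> [_ [_ sM sV]] As; have [Au Av] := sV _ As.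
by split=> // g gin; split; rewrite !sM.
Qed.

Lemma normalizesZ c A s : c != 0 -> A \in unitmx ->
  (forall g, g \in s -> A *m g *m invmx A \in s /\ invmx A *m g *m A \in s) ->
  normalizes (c *: A) s.
Proof.
move=> c0 Au hA; have cAu : c *: A \in unitmx by rewrite unitmxZ ?unitfE.
split=> // g gin; rewrite invmxZ // -!scalemxAl -!scalemxAr !scalerA.
by rewrite mulVf ?mulfV // !scale1r; apply: hA.
Qed.

Lemma group_invariant_lsub A s f : normalizes A s ->
  group_invariant s f -> group_invariant s (lsub A f).
Proof.
move=> [Au hA] hf g gin; rewrite lsub_lsub -[in RHS](hf _ (hA _ gin).1) lsub_lsub.
by rewrite mulmxKV.
Qed.

Lemma dual_harmonic_lsub A s f : normalizes A s ->
  dual_harmonic s f -> dual_harmonic s (lsub A f).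
Proof.
move=> [Au hA] hf p p0 hp; rewrite pdiff_lsub hf ?raddf0 ?lsub_coeff0 // => g gin.
rewrite lsub_lsub -trmx_mul -[in RHS](hp _ (hA _ gin).2) lsub_lsub -trmx_mul.
by rewrite !mulmxA mulmxV // mul1mx.
Qed.

End Normalizing.

(** * Covariants *)

Section Covariants.
Variables (K : fieldType) (charK0 : [pchar K] =i pred0) (n d : nat).
Local Notation mx := 'M[K]_n.
Local Notation S := {mpoly K[n]}.
Variables (s : seq mx) (gs : group_seq s) (rho : mx -> 'M[K]_d).
Hypothesis rho1 : rho 1%:M = 1%:M.
Hypothesis rhoM : forall x y, x \in s -> y \in s -> rho (x *m y) = rho x *m rho y.

Lemma dual_harmonic_lin : lin_closed (@dual_harmonic K n s).
Proof.
split=> [|x y hx hy|c x hx] p p0 hp; first by rewrite raddf0.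
  by rewrite raddfD /= hx // hy // addr0.
by rewrite pdiffZr hx // scaler0.
Qed.

Definition covariant (F : 'I_d -> S) : Prop :=
  (forall i, dual_harmonic s (F i)) /\
  (forall g, g \in s -> tensor_map (rho g) (invmx g) F = F).

(** The components of a covariant span a stable space, so a linear condition on all components
    passes to all their translates. *)
Lemma covariant_lsub F g k : covariant F -> g \in s ->
  lsub g (F k) = \sum_i rho g k i *: F i.
Proof.
move=> [_ hF] gin; have [_ [_ _ sV]] := gs; have [gu gV] := sV _ gin.
have := tensor_map_comp (rho g) (rho (invmx g)) 1%:M (invmx (invmx g)) F.
rewrite (hF _ gV) -(rhoM gin gV) (mulmxV gu) rho1 tensor_map1l mulmx1 invmxK => e.
rewrite -[LHS]/((fun i => lsub g (F i)) k) -e.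
by apply: eq_bigr => i _; rewrite lsub1.
Qed.

Lemma covariant_lin c F F' : covariant F -> covariant F' ->
  covariant (fun i => c *: F i + F' i).
Proof.
move=> [hF tF] [hF' tF']; split=> [i p p0 hp|g gin].
  by rewrite linearP /= hF // hF' // scaler0 addr0.
apply: functional_extensionality => i.
rewrite -[in RHS](tF g gin) -[in RHS](tF' g gin) /tensor_map scaler_sumr -big_split.
apply: eq_bigr => j _; rewrite [lsub _ _]linearP scalerDr /=.
by rewrite !scalerA mulrC.
Qed.

Lemma covariant_sum (I : finType) (c : I -> K) (F : I -> 'I_d -> S) :
  (forall k, covariant (F k)) -> covariant (fun i => \sum_k c k *: F k i).
Proof.
move=> hF; suff h (r : seq I) : covariant (fun i => \sum_(k <- r) c k *: F k i) by [].
elim: r => [|k r ih].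
  split=> [i p _ _|g _]; first by rewrite big_nil raddf0.
  apply: functional_extensionality => i; rewrite big_nil /tensor_map big1 // => j _.
  by rewrite big_nil raddf0 scaler0.
have -> : (fun i => \sum_(k <- k :: r) c k *: F k i) =
          fun i => c k *: F k i + \sum_(k <- r) c k *: F k i.
  by apply: functional_extensionality => i; rewrite big_cons.
exact: covariant_lin.
Qed.

Hypothesis s_gen : forall x, x \in s -> gen (fun r => r \in s /\ reflection r) x.

Lemma covariant_local_ideal_eq0 (w : seq mx) (v : 'cV[K]_n) F : group_seq w ->
  (forall g, g \in w -> g *m v = v) ->
  (forall r, r \in s -> reflection r -> r *m v = v -> r \in w) ->
  covariant F -> (forall i, local_ideal w v (F i)) -> forall i, F i = 0.
Proof.
move=> gw wfix wrefl cF hF i.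
apply: (harmonic_orbit_ideal_eq0 charK0 gs s_gen gw wfix wrefl); first by case: cF.
move=> g gin; rewrite covariant_lsub //.
have [_ _ hZ] := local_ideal_lin w v.
apply: (lin_closed_sum (P := local_ideal w v)) => [|j _]; first exact: local_ideal_lin.
exact: hZ.
Qed.

(** For the trivial local group, the local ideal at [u] consists of the polynomials vanishing at
    [u]. *)
Lemma covariant_free_point_eq0 (u : 'cV[K]_n) F :
  (forall g, g \in s -> g *m u = u -> g = 1%:M) ->
  covariant F -> (forall i, evalv (F i) u = 0) -> forall i, F i = 0.
Proof.
move=> hu cF hF; apply: (@covariant_local_ideal_eq0 [:: 1%:M] u) => //.
- split=> //; split=> [|x y|x]; rewrite ?mem_head // !inE.
    by move=> /eqP -> /eqP ->; rewrite mulmx1.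
  by move=> /eqP ->; rewrite unitmx1 invmx1 eqxx.
- by move=> g; rewrite inE => /eqP ->; rewrite mul1mx.
- by move=> r rs _ /hu ->; rewrite ?inE.
move=> i; rewrite -[F i]mul1r; apply: prodspanM => //; split=> // g.
by rewrite inE => /eqP ->; rewrite lsub1.
Qed.

(** [F k] is the orbit sum of [h] tensored with the [k]-th basis vector, where [h] is a harmonic
    equal to 1 at [u] and 0 elsewhere on its orbit; only the identity contributes at [u]. *)
Lemma covariant_interpolation (u : 'cV[K]_n) :
  (forall g, g \in s -> g *m u = u -> g = 1%:M) ->
  exists F : 'I_d -> 'I_d -> S, (forall k, covariant (F k)) /\
    forall k i, evalv (F k i) u = (i == k)%:R.
Proof.
move=> hu; have [us [s1 sM sV]] := gs.
have [h [hh hE]] := harmonic_separating charK0 gs hu.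
exists (fun k i => \sum_(g <- s) rho g i k *: lsub (invmx g) h); split=> [k|k i].
  split=> [i|g gin].
    rewrite big_seq; apply: (lin_closed_sum (P := dual_harmonic s)) => [|g gin].
      exact: dual_harmonic_lin.
    have [_ _ hZ] := dual_harmonic_lin; apply: hZ.
    by apply: dual_harmonic_lsub => //; apply: normalizes_mem => //; case: (sV _ gin).
  apply: functional_extensionality => i; rewrite /tensor_map.
  rewrite -[in RHS](perm_big _ (group_seq_perml gs gin)) big_map /=.
  transitivity (\sum_(x <- s) \sum_j (rho g i j * rho x j k) *: lsub (invmx x *m invmx g) h).
    rewrite exchange_big; apply: eq_bigr => j _.
    rewrite [lsub _ _]linear_sum scaler_sumr; apply: eq_bigr => x _.
    by rewrite linearZ /= lsub_lsub scalerA.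
  apply: eq_big_seq => x xs; have [xu _] := sV _ xs; have [gu _] := sV _ gin.
  by rewrite -scaler_suml (rhoM gin xs) (invmx_mul gu xu) [in RHS]mxE.
rewrite [evalv _ _]raddf_sum (bigD1_seq 1%:M) //= big_seq_cond big1 => [|g /andP[gin g1]].
  by rewrite -/(evalv _ _) evalvZ invmx1 hE // eqxx mulr1 addr0 rho1 mxE.
have [_ gV] := sV _ gin.
rewrite -/(evalv _ _) evalvZ hE // -(inj_eq (inv_inj (@invmxK _ _))) invmxK invmx1.
by rewrite (negbTE g1) mulr0.
Qed.

End Covariants.

(** * The map [eta] modulo the local ideal, and its equivariance *)

Section Eta.
Variables (K : fieldType) (charK0 : [pchar K] =i pred0) (n : nat).
Local Notation mx := 'M[K]_n.
Local Notation S := {mpoly K[n]}.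
Variables (w : seq mx) (gw : group_seq w) (v : 'cV[K]_n) (eta : S -> S).
Hypothesis eta_add : forall f g, eta (f + g) = eta f + eta g.
Hypothesis eta_scale : forall c f, eta (c *: f) = c *: eta f.
Hypothesis eta_def : forall a h, group_invariant w a -> dual_harmonic w h ->
  eta (a * h) = evalv a v *: h.

Let eta0 : eta 0 = 0. Proof. by have := eta_scale 0 0; rewrite !scale0r. Qed.

(** On a product, [a h - a(v) h = (a - a(v)) h], and [a - a(v)] is an invariant vanishing at [v]. *)
Lemma eta_spec f : local_ideal w v (f - eta f) /\ dual_harmonic w (eta f).
Proof.
have [_ HD HZ] := dual_harmonic_lin w.
elim: (invariants_times_harmonics charK0 f gw) => [|a h f' ha hh _ [hf' hef']].
  by rewrite eta0 subrr; split; [exact: Prodspan0 | move=> p _ _; rewrite raddf0].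
rewrite eta_add eta_def //; split; last by apply: HD => //; apply: HZ.
rewrite opprD addrACA -mul_mpolyC -mulrBl mulrC; apply: ProdspanD => //; split.
  by move=> g gin; rewrite raddfB /= ha // lsubC.
by rewrite evalvB evalvC subrr.
Qed.

(** The substitution preserves invariants and harmonics, and values at [v] because [A] fixes [v]. *)
Lemma eta_lsub A f : normalizes A w -> A *m v = v -> eta (lsub A f) = lsub A (eta f).
Proof.
move=> hA Av.
elim: (invariants_times_harmonics charK0 f gw) => [|a h f' ha hh _ ih].
  by rewrite !(raddf0, eta0).
rewrite raddfD /= rmorphM /= !eta_add [RHS]raddfD /= ih (eta_def ha hh) [in RHS]linearZ /=.
rewrite eta_def ?evalv_lsub ?Av //; first exact: group_invariant_lsub.
exact: dual_harmonic_lsub.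
Qed.

Lemma eta_sum I (r : seq I) (c : I -> K) (F : I -> S) :
  eta (\sum_(i <- r) c i *: F i) = \sum_(i <- r) c i *: eta (F i).
Proof.
elim: r => [|i r ih]; first by rewrite !big_nil eta0.
by rewrite !big_cons eta_add eta_scale ih.
Qed.

End Eta.

(** * Assembly of stability, injectivity, surjectivity and equivariance on covariants *)

Theorem theorem4p3
  (K : closedFieldType) (charK0 : [pchar K] =i pred0)
  (n : nat) (G : 'M[K]_n -> Prop) (HG : finite_reflection_group G)
  (v : 'cV[K]_n) (v_neq0 : v != 0)
  (Gamma : 'M[K]_n -> Prop) (HGamma : is_group Gamma)
  (Gamma_sub : forall x, Gamma x -> normaliser_line G v x)
  (theta : 'M[K]_n -> K)
  (theta_def : forall x, normaliser_line G v x -> x *m v = theta x *: v)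
  (d : nat) (rho : 'M[K]_n -> 'M[K]_d)
  (rho1 : rho 1%:M = 1%:M)
  (rhoM : forall x y, gen (fun z => G z \/ Gamma z) x ->
            gen (fun z => G z \/ Gamma z) y -> rho (x *m y) = rho x *m rho y)
  (eta : {mpoly K[n]} -> {mpoly K[n]})
  (eta_add : forall f g, eta (f + g) = eta f + eta g)
  (eta_scale : forall (c : K) f, eta (c *: f) = c *: eta f)
  (eta_def : forall a h, invariant_poly (Gv G v) a -> harmonic (Gv G v) h ->
               eta (a * h) = evalv a v *: h) :
  let Phi := fun (F : 'I_d -> {mpoly K[n]}) i => eta (F i) in
  [/\ (* source and target are Gamma-stable under the twisted actions *)
      (forall g F, Gamma g -> inv_harm_tensor rho G F ->
         inv_harm_tensor rho G (twact rho theta g F)) /\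
      (forall g F, Gamma g -> inv_harm_tensor rho (Gv G v) F ->
         inv_harm_tensor rho (Gv G v) (twact rho theta g F)),
      (* eta (x) Id maps (H (x) M)^G into (H_v (x) M)^{G_v} *)
      (forall F, inv_harm_tensor rho G F -> inv_harm_tensor rho (Gv G v) (Phi F)),
      (* ... injectively *)
      (forall F1 F2, inv_harm_tensor rho G F1 -> inv_harm_tensor rho G F2 ->
         Phi F1 = Phi F2 -> F1 = F2),
      (* ... surjectively *)
      (forall F', inv_harm_tensor rho (Gv G v) F' ->
         exists2 F, inv_harm_tensor rho G F & Phi F = F') &
      (* ... and Gamma-equivariantly for the theta_v-twisted graded actions *)
      (forall g F, Gamma g -> inv_harm_tensor rho G F ->
         Phi (twact rho theta g F) = twact rho theta g (Phi F))].
Proof.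
move=> Phi; have [gG [s0 hs0] G_gen] := HG.
have [s [gs hs]] := group_seq_exists gG (fun x => (hs0 x).1).
have Gu x : G x -> x \in unitmx by have [_ _ h] := gG; move/h => [].
have WG x : Gv G v x -> G x by apply: gen_sub_group => // y [].
have gW : is_group (Gv G v) by apply: is_group_gen => y [_ []].
have [w [gw hw]] := group_seq_exists gW (fun x Wx => (hs0 x).1 (WG x Wx)).
have ws x : x \in w -> x \in s by move/hw/WG/hs.
have wv g : g \in w -> g *m v = v by move/hw/Gv_fix.
have w_refl r : r \in s -> reflection r -> r *m v = v -> r \in w.
  by move=> /hs Gr rr rv; apply/hw/gen_incl.
have s_gen x : x \in s -> gen (fun r => r \in s /\ reflection r) x.
  by move=> /hs /G_gen; apply: gen_mono => y [/hs ? ?].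
have w_gen x : x \in w -> gen (fun r => r \in w /\ reflection r) x.
  by move=> /hw; apply: gen_mono => y [Gy ry yv]; split=> //; apply/hw/gen_incl.
have genG x : G x -> gen (fun z => G z \/ Gamma z) x by move=> Gx; apply: gen_incl; left.
have rhoMs x y : x \in s -> y \in s -> rho (x *m y) = rho x *m rho y.
  by move=> /hs Gx /hs Gy; apply: rhoM; apply: genG.
have rhoMw x y : x \in w -> y \in w -> rho (x *m y) = rho x *m rho y.
  by move=> /ws xs /ws ys; apply: rhoMs.
have covP X t F : group_seq t -> (forall x, X x <-> x \in t) ->
    inv_harm_tensor rho X F <-> covariant t rho F.
  move=> gt ht; split=> -[hF tF]; split=> [i|g /ht ?].
  - exact/(harmonicP charK0 _ gt ht).
  - by rewrite -tact_tensor_map tF.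
  - exact/(harmonicP charK0 _ gt ht).
  - by rewrite tact_tensor_map tF.
have eta_def' a h : group_invariant w a -> dual_harmonic w h -> eta (a * h) = evalv a v *: h.
  move=> ha hh; apply: eta_def; last exact/(harmonicP charK0 _ gw hw).
  move=> g /hw gin; rewrite actE; apply: ha.
  by have [_ [_ _ wV]] := gw; case: (wV _ gin).
have espec := eta_spec charK0 gw eta_add eta_scale eta_def'.
have Phi_tensor R A F : normalizes A w -> A *m v = v ->
    Phi (tensor_map R A F) = tensor_map R A (Phi F).
  move=> hA Av; apply: functional_extensionality => i.
  rewrite /Phi /tensor_map (eta_sum eta_add eta_scale); apply: eq_bigr => j _.
  by rewrite (eta_lsub charK0 gw eta_add eta_scale eta_def').
(* [theta^-1 g] normalizes [G] and fixes [v]; the twisted action of [g] is its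
   ordinary action on polynomials, since the grading is given by the scalars. *)
have Gamma_props g : Gamma g -> [/\ g \in unitmx, theta g != 0, g *m v = theta g *: v,
    (forall x, x \in s -> invmx g *m x *m g \in s /\ g *m x *m invmx g \in s) &
    (forall x, x \in w -> invmx g *m x *m g \in w /\ g *m x *m invmx g \in w)].
  move=> Gg; have nl := Gamma_sub _ Gg; have [[gu gn] _] := nl.
  have gv := theta_def _ nl.
  have t0 : theta g != 0.
    apply: contraNneq v_neq0 => t0; rewrite -(mulKmx gu v) gv t0 scale0r mulmx0.
    by rewrite eqxx.
  have gVv : invmx g *m v = (theta g)^-1 *: v.
    by rewrite -[v in LHS](scalerK t0) -gv -scalemxAr mulKmx.
  have GJ x : G x -> G (g *m x *m invmx g) by move/gn.
  have GJV x : G x -> G (invmx g *m x *m invmx (invmx g)).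
    move=> Gx; apply/gn; rewrite invmxK !mulmxA mulmxV // mul1mx.
    by rewrite mulmxK.
  have gVu : invmx g \in unitmx by rewrite unitmx_inv.
  have t0V : (theta g)^-1 != 0 by rewrite invr_eq0.
  split=> // x; [move/hs|move/hw] => Xx; split; [apply/hs|apply/hs|apply/hw|apply/hw].
  - by rewrite -[X in _ *m X](invmxK g); apply: GJV.
  - exact: GJ.
  - by rewrite -[X in _ *m X](invmxK g); apply: Gv_conj gVu t0V gVv GJV _ Xx.
  - exact: Gv_conj gu t0 gv GJ _ Xx.
have twist_props g : Gamma g -> let A := invmx g *m (theta g)%:M in
    [/\ A *m v = v, normalizes A s & normalizes A w].
  move=> /Gamma_props[gu t0 gv hgs hgw] A.
  have -> : A = theta g *: invmx g by rewrite /A mul_mx_scalar.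
  split; first by rewrite -scalemxAl scalemxAr -gv mulKmx.
    by apply: normalizesZ; rewrite ?unitmx_inv // invmxK.
  by apply: normalizesZ; rewrite ?unitmx_inv // invmxK.
have stable t g F : Gamma g -> group_seq t -> (forall x, x \in t -> x \in s) ->
    (forall x, x \in t -> invmx g *m x *m g \in t) ->
    normalizes (invmx g *m (theta g)%:M) t ->
    covariant t rho F -> covariant t rho (twact rho theta g F).
  move=> Gg gt ts tJ nA [hF tF]; rewrite twact_tensor_map; split=> [i|x xt].
    have [_ _ hZ] := dual_harmonic_lin t.
    apply: (lin_closed_sum (P := dual_harmonic t)) => [|j _]; first exact: dual_harmonic_lin.
    by apply: hZ; apply: dual_harmonic_lsub.
  have [gu _ _ _ _] := Gamma_props _ Gg.
  have gen_g : gen (fun z => G z \/ Gamma z) g by apply: gen_incl; right.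
  have gen_t z : z \in t -> gen (fun z => G z \/ Gamma z) z by move=> /ts/hs/genG.
  have xu : x \in unitmx by apply: Gu; apply/hs/ts.
  (* [x (g F) = g ((g^-1 x g) F)] and the conjugate fixes [F]; the scalar of the twist commutes with
     every matrix. *)
  rewrite -[in RHS](tF _ (tJ _ xt)) !tensor_map_comp.
  congr tensor_map; first rewrite -!rhoM //.
  - by congr rho; rewrite !mulmxA mulmxV // mul1mx.
  - by apply: gen_t; apply: tJ.
  - exact: gen_t.
  rewrite !invmx_mul ?unitmx_mul ?unitmx_inv ?gu // invmxK.
  by rewrite !mul_mx_scalar -scalemxAl -scalemxAr !mulmxA mulmxK.
have PhiW F : covariant s rho F -> covariant w rho (Phi F).
  move=> [hF tF]; split=> [i|g gin]; first by case: (espec (F i)).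
  rewrite -Phi_tensor ?tF //; first exact: ws.
    by apply: normalizes_mem => //; have [_ [_ _ wV]] := gw; case: (wV _ gin).
  by apply: wv; have [_ [_ _ wV]] := gw; case: (wV _ gin).
have Phi_inj F : covariant s rho F -> (forall i, Phi F i = 0) -> forall i, F i = 0.
  move=> cF PF; apply: (covariant_local_ideal_eq0 charK0 gs rho1 rhoMs s_gen gw wv w_refl cF).
  by move=> i; rewrite -[F i]subr0 -(PF i); case: (espec (F i)).
split.
- split=> g F Gg.
    move=> /(covP _ _ _ gs hs) cF; apply/(covP _ _ _ gs hs).
    have [_ _ _ hgs _] := Gamma_props _ Gg; have [_ nA _] := twist_props _ Gg.
    by apply: stable => // x xs; case: (hgs _ xs).
  move=> /(covP _ _ _ gw hw) cF; apply/(covP _ _ _ gw hw).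
  have [_ _ _ _ hgw] := Gamma_props _ Gg; have [_ _ nA] := twist_props _ Gg.
  by apply: stable => // x xw; case: (hgw _ xw).
- by move=> F /(covP _ _ _ gs hs) /PhiW cF; apply/(covP _ _ _ gw hw).
- move=> F1 F2 /(covP _ _ _ gs hs) c1 /(covP _ _ _ gs hs) c2 e.
  have c12 := covariant_lin (-1) c2 c1.
  apply: functional_extensionality => i; apply/eqP; rewrite -subr_eq0 addrC -scaleN1r.
  apply/eqP; apply: (Phi_inj _ c12) => j.
  have ej : eta (F1 j) = eta (F2 j) by rewrite -[LHS]/(Phi F1 j) e.
  by rewrite /Phi eta_add eta_scale ej scaleN1r addNr.
- move=> F' /(covP _ _ _ gw hw) cF'.
  (* A point free for [G] is free for its subgroup [Gv G v], so [u] serves both source and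
     target. *)
  have [u hu] := free_point charK0 s.
  have huw g : g \in w -> g *m u = u -> g = 1%:M by move=> /ws; apply: hu.
  have [B [cB BE]] := covariant_interpolation charK0 gs rho1 rhoMs hu.
  pose comb (x : 'rV[K]_d) : 'I_d -> {mpoly K[n]} := fun i => \sum_k x 0 k *: B k i.
  have cov_comb x : covariant s rho (comb x) by apply: covariant_sum.
  (* The matrix of [x |-> eta (comb x)] evaluated at [u]; it is square, so a trivial kernel gives
     invertibility. *)
  pose M : 'M[K]_d := \matrix_(k, i) evalv (eta (B k i)) u.
  have combE x i : evalv (eta (comb x i)) u = (x *m M) 0 i.
    rewrite /comb (eta_sum eta_add eta_scale) mxE [evalv _ _]raddf_sum.
    by apply: eq_bigr => k _; rewrite mxE -evalvZ.
  have eq0W := covariant_free_point_eq0 charK0 gw rho1 rhoMw w_gen huw.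
  have Mu : M \in unitmx.
    (* A row [x] in the kernel gives a target covariant vanishing at [u], hence zero; by injectivity
       [comb x] is zero, and its value at [u] is [x]. *)
    rewrite -row_free_unit -kermx_eq0; apply/rowV0P => x /sub_kermxP xM.
    have comb0 : forall i, comb x i = 0.
      apply: Phi_inj => // i; apply: (eq0W _ (PhiW _ (cov_comb x))) => j.
      by rewrite combE xM mxE.
    apply/rowP => i; rewrite mxE -[RHS](meval0 (fun j => u j ord0)) -(comb0 i).
    rewrite [RHS]raddf_sum (bigD1 i) //= big1 => [|k ne]; rewrite -/(evalv _ _) evalvZ BE.
      by rewrite eqxx mulr1 addr0.
    by rewrite eq_sym (negbTE ne) mulr0.
  (* With these coefficients [Phi (comb x)] and [F'] agree at [u], so their difference is a
     covariant vanishing at a free point. *)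
  pose x := (\row_i evalv (F' i) u) *m invmx M.
  exists (comb x); first exact/(covP _ _ _ gs hs).
  have cD := covariant_lin (-1) cF' (PhiW _ (cov_comb x)).
  apply: functional_extensionality => i; apply/eqP; rewrite -subr_eq0 addrC -scaleN1r.
  apply/eqP; apply: (eq0W _ cD) => j.
  by rewrite evalvD evalvZ /Phi combE mulmxKV // mxE mulN1r addNr.
(* The twisted action substitutes a matrix that fixes [v] and normalises [w], so it commutes with
   [eta]. *)
- move=> g F Gg _; have [Av _ nA] := twist_props _ Gg.
  by rewrite !twact_tensor_map Phi_tensor.
Qed.
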